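(* The set of totally real quartic fields $F$ for which there exist a totally positive $\alpha\in F$ and a maximal order $\mathcal{O}\subseteq B=\left(\frac{-1,-1}{F}\right)$ such that $\Lambda_{(\mathcal{O},\alpha)}$ is similar to $E_8^2=E_8\oplus E_8$ is infinite.
   Context: $B=\left(\frac{-1,-1}{F}\right)$ has $F$-basis $1,i,j,k$ with $i^2=j^2=-1$, $ij=-ji=k$. With $\sigma_1,\dots,\sigma_4$ the real embeddings of $F$ and $\alpha$ totally positive, $\sigma_{B,\alpha}:B\to\mathbb{R}^{16}$ sends $x+yi+zj+tk$ ($x,y,z,t\in F$) to $(\sqrt{2\sigma_1(\alpha)}\sigma_1(x),\dots,\sqrt{2\sigma_4(\alpha)}\sigma_4(x),\dots,\sqrt{2\sigma_1(\alpha)}\sigma_1(t),\dots,\sqrt{2\sigma_4(\alpha)}\sigma_4(t))$, and $\Lambda_{(\mathcal{O},\alpha)}=\sigma_{B,\alpha}(\mathcal{O})$. A maximal order is a subring containing $1$, finitely generated as a $\mathbb{Z}_F$-module and spanning $B$, not properly contained in another. Similar means equal up to isometry and scaling; $E_8$ is the unique even unimodular lattice of dimension 8 and $E_8^2$ is the orthogonal direct sum of two copies. *)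

(* Defs.v *)
From HB Require Import structures.
From mathcomp Require Import all_boot all_order all_algebra all_field.
From mathcomp Require Import boolp classical_sets functions cardinality reals.
From mathcomp Require Import complex.
From mathcomp Require Import ring lra zify.
Set Implicit Arguments.
Unset Strict Implicit.
Unset Printing Implicit Defensive.
Import Order.TTheory GRing.Theory Num.Theory.

Local Open Scope ring_scope.
Local Open Scope classical_set_scope.

(** * The quaternion algebra (-1, -1 / F) *)

(* [Quat x y z t] stands for x + y i + z j + t k. *)
Record quat (F : Type) : Type := Quat { q1 : F; qi : F; qj : F; qk : F }.

Definition quat_to_seq (F : Type) (u : quat F) : seq F :=
  let: Quat x y z t := u in [:: x; y; z; t].
Definition seq_to_quat (F : Type) (s : seq F) : option (quat F) :=
  if s is [:: x; y; z; t] then Some (Quat x y z t) else None.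
Lemma quat_to_seqK (F : Type) : pcancel (@quat_to_seq F) (@seq_to_quat F).
Proof. by case. Qed.

HB.instance Definition _ (F : eqType) :=
  Equality.copy (quat F) (pcan_type (@quat_to_seqK F)).
HB.instance Definition _ (F : choiceType) :=
  Choice.copy (quat F) (pcan_type (@quat_to_seqK F)).

Section QuatAlgebra.
Variable F : fieldType.
Implicit Types u v w : quat F.

Definition quat_add u v : quat F :=
  Quat (q1 u + q1 v) (qi u + qi v) (qj u + qj v) (qk u + qk v).
Definition quat_opp u : quat F := Quat (- q1 u) (- qi u) (- qj u) (- qk u).
Definition quat_scale (a : F) u : quat F :=
  Quat (a * q1 u) (a * qi u) (a * qj u) (a * qk u).
Definition quat_mul u v : quat F :=
  Quat (q1 u * q1 v - qi u * qi v - qj u * qj v - qk u * qk v)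
       (q1 u * qi v + qi u * q1 v + qj u * qk v - qk u * qj v)
       (q1 u * qj v + qj u * q1 v + qk u * qi v - qi u * qk v)
       (q1 u * qk v + qk u * q1 v + qi u * qj v - qj u * qi v).

Fact quat_addA : associative quat_add.
Proof. by case=> ????[????][????]; rewrite /quat_add /= !addrA. Qed.
Fact quat_addC : commutative quat_add.
Proof. by case=> ????[????]; congr Quat; rewrite /= addrC. Qed.
Fact quat_add0 : left_id (Quat 0 0 0 0) quat_add.
Proof. by case=> ????; rewrite /quat_add /= !add0r. Qed.
Fact quat_addN : left_inverse (Quat 0 0 0 0) quat_opp quat_add.
Proof. by case=> ????; rewrite /quat_add /= !addNr. Qed.
HB.instance Definition _ := GRing.isZmodule.Build (quat F)
  quat_addA quat_addC quat_add0 quat_addN.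

Fact quat_mulA : associative quat_mul.
Proof. by case=> ????[????][????]; congr Quat => /=; ring. Qed.
Fact quat_mul1l : left_id (Quat 1 0 0 0) quat_mul.
Proof. by case=> ????; congr Quat => /=; ring. Qed.
Fact quat_mul1r : right_id (Quat 1 0 0 0) quat_mul.
Proof. by case=> ????; congr Quat => /=; ring. Qed.
Fact quat_mulDl : left_distributive quat_mul +%R.
Proof. by case=> ????[????][????]; congr Quat => /=; ring. Qed.
Fact quat_mulDr : right_distributive quat_mul +%R.
Proof. by case=> ????[????][????]; congr Quat => /=; ring. Qed.
Fact quat_one_neq0 : Quat 1 0 0 0 != 0 :> quat F.
Proof. by apply/eqP => -[] /eqP; rewrite oner_eq0. Qed.
HB.instance Definition _ := GRing.Zmodule_isNzRing.Build (quat F)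
  quat_mulA quat_mul1l quat_mul1r quat_mulDl quat_mulDr quat_one_neq0.

Fact quat_scaleA a b u : quat_scale a (quat_scale b u) = quat_scale (a * b) u.
Proof. by case: u => ????; rewrite /quat_scale /= !mulrA. Qed.
Fact quat_scale1 : left_id 1 quat_scale.
Proof. by case=> ????; rewrite /quat_scale /= !mul1r. Qed.
Fact quat_scaleDr : right_distributive quat_scale +%R.
Proof. by move=> a [????][????]; congr Quat => /=; ring. Qed.
Fact quat_scaleDl u : {morph quat_scale^~ u : a b / a + b}.
Proof. by move=> a b; case: u => ????; congr Quat => /=; ring. Qed.
HB.instance Definition _ := GRing.Zmodule_isLmodule.Build F (quat F)
  quat_scaleA quat_scale1 quat_scaleDr quat_scaleDl.

Fact quat_scaleAl (a : F) u v : a *: (u * v) = (a *: u) * v.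
Proof. by case: u v => ????[????]; congr Quat => /=; ring. Qed.
HB.instance Definition _ :=
  GRing.Lmodule_isLalgebra.Build F (quat F) quat_scaleAl.
Fact quat_scaleAr (a : F) u v : a *: (u * v) = u * (a *: v).
Proof. by case: u v => ????[????]; congr Quat => /=; ring. Qed.
HB.instance Definition _ :=
  GRing.Lalgebra_isAlgebra.Build F (quat F) quat_scaleAr.

Definition quatI : quat F := Quat 0 1 0 0.
Definition quatJ : quat F := Quat 0 0 1 0.
Definition quatK : quat F := Quat 0 0 0 1.

Lemma quat_basisE x y z t :
  Quat x y z t = x *: 1 + y *: quatI + z *: quatJ + t *: quatK.
Proof. by congr Quat => /=; ring. Qed.
Lemma quatII : quatI * quatI = - 1. Proof. by congr Quat => /=; ring. Qed.
Lemma quatJJ : quatJ * quatJ = - 1. Proof. by congr Quat => /=; ring. Qed.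
Lemma quatIJ : quatI * quatJ = quatK. Proof. by congr Quat => /=; ring. Qed.
Lemma quatJI : quatJ * quatI = - quatK. Proof. by congr Quat => /=; ring. Qed.

End QuatAlgebra.

(** * Number fields and orders *)

Definition field_iso (F K : fieldExtType rat) : Prop :=
  exists f : {rmorphism F -> K}, bijective f.

(* [set] and [infinite_set] do not apply to the type of number fields, for
   universe reasons, and fields are to be counted up to isomorphism. *)
Definition infinitely_many_fields (P : fieldExtType rat -> Prop) : Prop :=
  ~ exists (n : nat) (K : 'I_n -> fieldExtType rat),
      forall F, P F -> exists l, field_iso F (K l).

Definition ring_of_integers (F : fieldExtType rat) : set F :=
  [set x | integralOver (intr : int -> F) x].

Definition totally_real (R : realType) (F : fieldExtType rat) : Prop :=
  forall (f : {rmorphism F -> R[i]}) (x : F), complex.Im (f x) = 0.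

Definition totally_positive (R : realType) (F : fieldExtType rat) (a : F) :
  Prop := forall f : {rmorphism F -> R}, 0 < f a.

Definition real_embeddings (R : realType) (F : fieldExtType rat) (n : nat)
    (sigma : 'I_n -> {rmorphism F -> R}) : Prop :=
  (forall l m, sigma l =1 sigma m -> l = m) /\
  (forall f : {rmorphism F -> R}, exists l, f =1 sigma l).

Definition is_order (F : fieldExtType rat) (O : set (quat F)) : Prop :=
  [/\ GRing.subring_closed (mem O),
      exists (n : nat) (b : 'I_n -> quat F),
        O = [set x | exists2 c : 'I_n -> F,
               forall l, ring_of_integers (c l) & x = \sum_l c l *: b l]
    & forall x : quat F, exists (n : nat) (c : 'I_n -> F) (b : 'I_n -> quat F),
        (forall l, O (b l)) /\ x = \sum_l c l *: b l].

Definition is_maximal_order (F : fieldExtType rat) (O : set (quat F)) : Prop :=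
  is_order O /\ forall O' : set (quat F), is_order O' -> ~ (O `<` O').

(* The matrix has rows indexed by 1, i, j, k and columns by the embeddings;
   [mxvec] lists its entries row by row. *)
Definition quat_embedding (R : realType) (F : fieldExtType rat)
    (sigma : 'I_4 -> {rmorphism F -> R}) (a : F) (u : quat F) : 'rV[R]_16 :=
  mxvec (\matrix_(l < 4, m < 4)
    (Num.sqrt (2 * sigma m a) * sigma m (quat_to_seq u)`_l)).

(** * Euclidean lattices *)

(* Sets of row vectors of R^n, with the standard inner product. *)

Definition similar_lattices (R : realType) (n : nat) (L M : set 'rV[R]_n) :
  Prop := exists (c : R) (Q : 'M[R]_n),
    [/\ 0 < c, Q *m Q^T = 1%:M & M = [set c *: (v *m Q) | v in L]].

Definition E8 (R : realType) : set 'rV[R]_8 :=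
  [set v | ((forall l, v 0 l \is a Num.int) \/
            (forall l, v 0 l - 2^-1 \is a Num.int)) /\
           (\sum_l v 0 l) / 2 \is a Num.int].

Definition E8_squared (R : realType) : set 'rV[R]_16 :=
  [set row_mx v.1 v.2 | v in (@E8 R) `*` (@E8 R)].

(* A full-rank lattice with even norms and Gram determinant 1. *)
Definition even_unimodular (R : realType) (n : nat) (L : set 'rV[R]_n) : Prop :=
  exists2 M : 'M[R]_n,
    L = [set map_mx intr c *m M | c in [set: 'rV[int]_n]]
  & \det (M *m M^T) = 1 /\ forall v, L v -> (v *m v^T) 0 0 / 2 \is a Num.int.

Section E8EvenUnimodular.
Variable R : realType.

Definition E8_basis : 'M[R]_8 := \matrix_(l, m)
  (if l == 0%N :> nat then (if m == 0%N :> nat then 2 else 0)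
   else if l == 7%N :> nat then 2^-1
   else if m == l then 1 else if m.+1 == l then -1 else 0).

Lemma det_E8_basis : \det E8_basis = 1.
Proof.
rewrite det_trig; first by rewrite !big_ord_recl big_ord0 !mxE /=; field.
apply/is_trig_mxP => l m lm; rewrite mxE -val_eqE /=.
have := ltn_ord m.
by repeat case: ifP => //; move=> *; exfalso; lia.
Qed.

Lemma E8_coordP (v : 'rV[R]_8) : E8 v -> exists (m : 'I_8 -> int) (h : bool)
  (s : int), (forall l, v 0 l = (m l)%:~R + h%:R / 2) /\
             \sum_l v 0 l = 2 * s%:~R.
Proof.
case=> vint /intrP[s sE].
have sumE : \sum_l v 0 l = 2 * s%:~R by rewrite -sE; field.
case: vint => vint.
- have /choice[m mE] l : exists z : int, v 0 l = z%:~R by apply/intrP.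
  by exists m, false, s; split=> // l; rewrite mE mul0r addr0.
- have /choice[m mE] l : exists z : int, v 0 l - 2^-1 = z%:~R by apply/intrP.
  by exists m, true, s; split=> // l; rewrite -mE mul1r subrK.
Qed.

Lemma E8_latticeE :
  @E8 R = [set map_mx intr c *m E8_basis | c in [set: 'rV[int]_8]].
Proof.
rewrite eqEsubset; split=> v.
- move=> /E8_coordP[m [h [s [vE sumE]]]].
  pose z (n : nat) : int := m (inord n).
  have vzE l : v 0 l = (z l)%:~R + h%:R / 2 by rewrite /z inord_val.
  pose c7 : int := z 7%N *+ 2 + h%:Z.
  pose c6 : int := z 6%N - z 7%N.
  pose c5 : int := z 5%N - z 7%N + c6.
  pose c4 : int := z 4%N - z 7%N + c5.
  pose c3 : int := z 3%N - z 7%N + c4.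
  pose c2 : int := z 2%N - z 7%N + c3.
  pose c1 : int := z 1%N - z 7%N + c2.
  pose c0 : int := s - c7 *+ 2.
  pose cs := [:: c0; c1; c2; c3; c4; c5; c6; c7].
  exists (\row_l cs`_l) => //.
  have hE : (h%:Z)%:~R = h%:R :> R by clear; case: h.
  move: sumE; rewrite !big_ord_recl big_ord0 !vzE /= => sumE.
  apply/rowP => l; rewrite !mxE vzE !big_ord_recl big_ord0 !mxE -!val_eqE /=.
  case: l => l lt8; rewrite /= /cs.
  do 8?[case: l lt8 => [|l] lt8 /=]; last by [];
    rewrite /c0 /c1 /c2 /c3 /c4 /c5 /c6 /c7;
    rewrite ?(intrD, rmorphB, rmorphMn, rmorphN) /= ?hE;
    rewrite /bump /= in sumE *; lra.
- case=> c _ <-.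
  pose z (n : nat) : int := c 0 (inord n).
  have czE (l : 'I_8) : c 0 l = z l by rewrite /z inord_val.
  pose p : 'I_8 -> int := fun l =>
    [:: z 0%N *+ 2 - z 1%N; z 1%N - z 2%N; z 2%N - z 3%N; z 3%N - z 4%N;
        z 4%N - z 5%N; z 5%N - z 6%N; z 6%N; 0]`_l.
  have pE l : (map_mx intr c *m E8_basis) 0 l = (p l)%:~R + (z 7%N)%:~R / 2.
    rewrite !mxE !big_ord_recl big_ord0 !mxE -!val_eqE /= !czE /bump /=.
    case: l => l lt8; rewrite /p /=.
    by do 8?[case: l lt8 => [|l] lt8 /=]; last by [];
      rewrite ?(intrD, rmorphB, rmorphMn, rmorphN) /=; lra.
  split; last first.
    apply/intrP; exists (z 0%N + z 7%N *+ 2).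
    rewrite (eq_bigr _ (fun l _ => pE l)) !big_ord_recl big_ord0 /p /=.
    by rewrite ?(intrD, rmorphB, rmorphMn, rmorphN) /=; lra.
  have [q [h zE]] : exists (q : int) (h : bool), z 7%N = q *+ 2 + h%:Z.
    exists (z 7%N %/ 2)%Z, (z 7%N %% 2 == 1)%Z.
    by case: eqP; lia.
  case: h zE => zE; [right|left] => l; apply/intrP; exists (p l + q);
    rewrite pE zE !(intrD, rmorphMn) /=; lra.
Qed.

Lemma E8_even (v : 'rV[R]_8) : E8 v -> (v *m v^T) 0 0 / 2 \is a Num.int.
Proof.
move=> /E8_coordP[m [h [s [vE sumE]]]].
pose w l : int := (m l * (m l - 1) %/ 2)%Z.
have wE l : (m l)%:~R ^+ 2 = (m l)%:~R + 2 * (w l)%:~R :> R.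
  have : m l ^+ 2 = m l + 2 * w l.
    have parity (k : int) : k ^+ 2 = k + 2 * (k * (k - 1) %/ 2)%Z.
      have [q [b ->]] : exists (q : int) (b : bool), k = q *+ 2 + b%:Z.
        exists (k %/ 2)%Z, (k %% 2 == 1)%Z.
        by case: eqP; lia.
      by case: b => /=; nia.
    exact: parity.
  by move/(congr1 (fun k : int => k%:~R : R)); rewrite intrD intrM rmorphXn.
apply/intrP; exists (\sum_l w l + s + h%:Z * (s - 3)).
have hE : (h%:Z)%:~R = h%:R :> R by clear; case: h.
rewrite mxE.
under eq_bigr => l _ do rewrite mxE.
move: sumE; rewrite !intrD raddf_sum /= !big_ord_recl !big_ord0 !vE.
move=> sumE.
have E l : ((m l)%:~R + h%:R / 2) * ((m l)%:~R + h%:R / 2) =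
   (m l)%:~R + 2 * (w l)%:~R + h%:R * (m l)%:~R + h%:R / 4 :> R.
  have := wE l; rewrite expr2 => ww; case: (h) => /=; lra.
rewrite !intrM !rmorphB /= hE !E.
by move: sumE; clear; case: h => /= sumE; lra.
Qed.

Lemma E8_even_unimodular : even_unimodular (@E8 R).
Proof.
exists E8_basis; first exact: E8_latticeE.
by split; [rewrite det_mulmx det_tr det_E8_basis mulr1 | exact: E8_even].
Qed.

End E8EvenUnimodular.

(* Main.v *)
(* Let n be odd and n^2 + 4 = d m^2 with d squarefree, and F = Q(sqrt 2, sqrt d).
   Since eps = (n + m sqrt d) / 2 is a unit of norm -1, the element eps / sqrt d
   is totally positive and twisting the trace form of Z[(1 + sqrt d) / 2] by it
   gives a positive definite unimodular binary form, isometric to Z^2 by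
   reduction.  Similarly (2 + sqrt 2) / 4 turns the order of (-1, -1 / Q(sqrt 2))
   spanned by 1, (1 + i) / sqrt 2, (1 + j) / sqrt 2, (1 + i + j + k) / 2 into E8.
   The discriminants 8 and d being coprime, Z_F = Z[sqrt 2] (x) Z[(1 + sqrt d) / 2],
   and the Z_F-span of the same four quaternions, twisted by the product of both
   elements, is E8 (x) Z^2 = E8 + E8.  It is a maximal order because it is its own
   dual for the reduced trace.  The fields are infinitely many because d can be
   made exactly divisible by an arbitrarily large prime. *)
From HB Require Import structures.
Require Import Defs.
From mathcomp Require Import all_boot all_order all_algebra all_field.
From mathcomp Require Import boolp classical_sets functions cardinality reals.
From mathcomp Require Import complex.
From mathcomp Require Import ring lra zify.
Set Implicit Arguments.
Unset Strict Implicit.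
Unset Printing Implicit Defensive.
Import Order.TTheory GRing.Theory Num.Theory.
Local Open Scope ring_scope.

(** * Binary forms and the parameters n, d, m *)

(** Reduction of the positive definite form with Gram matrix [[A, B], [B, C]] of determinant 1.
    While [B] is nonzero, [A] or [C] is at most [|B|], and adding or subtracting one basis vector
    from the other lowers [|B|]; at [B = 0] the form is X^2 + Y^2. *)
Lemma binary_unimodular (A B C : int) : 0 < A -> A * C = B ^+ 2 + 1 ->
  exists p q r s : int, [/\ A = p ^+ 2 + r ^+ 2, B = p * q + r * s,
    C = q ^+ 2 + s ^+ 2 & p * s - q * r = 1].
Proof.
have [k] := ubnP `|B|%N; elim: k A B C => // k IHk A B C ltBk A0 AC.
have C0 : 0 < C by rewrite -(pmulr_rgt0 _ A0) AC ltr_wpDl ?sqr_ge0.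
have [B0|B0] := eqVneq B 0.
  subst B; rewrite expr0n /= add0r in AC.
  have A1 : A = 1 by nia.
  have C1 : C = 1 by nia.
  by exists 1, 0, 0, 1; subst.
have shrink (X : int) : 0 < X -> X <= `|B| ->
    exists e : int, e ^+ 2 = 1 /\ `|B - e * X| < `|B|.
  by move=> X0 leX; have [B1|B1] := lerP 0 B; [exists 1|exists (-1)]; split=> //; lia.
have [leAB|ltBA] := lerP A `|B|.
  have [e [e1 ltB]] := shrink A A0 leAB.
  have [||| p [q [r [s [E1 E2 E3 E4]]]]] :=
      IHk (A) (B - e * A) (C - 2 * e * B + A) => //; first lia.
    have -> : A * (C - 2 * e * B + A) = A * C - 2 * e * A * B + A ^+ 2 by ring.
    by rewrite AC (_ : A ^+ 2 = e ^+ 2 * A ^+ 2); [ring | rewrite e1 mul1r].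
  exists p, (q + e * p), r, (s + e * r); split=> //.
  - by rewrite -[B](subrK (e * A)) E2 E1; ring.
  - have -> : C = (C - 2 * e * B + A) + 2 * e * (B - e * A) + (2 * e ^+ 2 - 1) * A by ring.
    rewrite E3 E2 e1 E1; transitivity (q ^+ 2 + s ^+ 2 + 2 * e * (p * q + r * s) +
      1 * (p ^+ 2 + r ^+ 2)); first by ring.
    by rewrite -[in 1 * _]e1; ring.
  - by rewrite -E4; ring.
(* Otherwise [A] and [C] are both at least [|B| + 1], and [A * C] exceeds [B ^ 2 + 1]. *)
have leCB : C <= `|B|.
  rewrite leNgt; apply/negP => ltBC.
  have : (`|B| + 1) * (`|B| + 1) <= A * C by apply: ler_pM; lia.
  rewrite AC -(real_normK (num_real B)).
  have : 0 < `|B| by rewrite normr_gt0.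
  by clear; nia.
have [e [e1 ltB]] := shrink C C0 leCB.
have CE : (A - 2 * e * B + C) * C = (B - e * C) ^+ 2 + 1.
  have -> : (A - 2 * e * B + C) * C = A * C - 2 * e * B * C + C ^+ 2 by ring.
  by rewrite AC (_ : C ^+ 2 = e ^+ 2 * C ^+ 2); [ring | rewrite e1 mul1r].
have A'0 : 0 < A - 2 * e * B + C.
  by rewrite -(pmulr_lgt0 _ C0) CE ltr_wpDl ?sqr_ge0.
have [||| p [q [r [s [E1 E2 E3 E4]]]]] :=
    IHk (A - 2 * e * B + C) (B - e * C) (C) => //; first lia.
exists (p + e * q), q, (r + e * s), s; split=> //.
- have -> : A = (A - 2 * e * B + C) + 2 * e * (B - e * C) + (2 * e ^+ 2 - 1) * C by ring.
  rewrite E2 e1 E1 E3; transitivity (p ^+ 2 + r ^+ 2 + 2 * e * (p * q + r * s) +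
      1 * (q ^+ 2 + s ^+ 2)); first by ring.
  by rewrite -[in 1 * _]e1; ring.
- by rewrite -[B](subrK (e * C)) E2 E3; ring.
- by rewrite -E4; ring.
Qed.

Definition squarefree (d : nat) := forall r, prime r -> ~~ (r ^ 2 %| d)%N.

Lemma squarefree_part (N : nat) : (0 < N)%N ->
  exists d m, N = (d * m ^ 2)%N /\ squarefree d.
Proof.
elim/ltn_ind: N => N IHN N0.
have [|sqf] := pselect (exists r, prime r /\ (r ^ 2 %| N)%N); last first.
  exists N, 1%N; split=> [|r pr]; first by rewrite muln1.
  by apply/negP => rN; apply: sqf; exists r.
case=> r [pr /dvdnP[N' NE]]; have r1 := prime_gt1 pr.
have [||d [m [N'E sqf]]] := IHN N'; [nia|nia|].
by exists d, (m * r)%N; split=> //; rewrite NE N'E expnMn mulnA.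
Qed.

(* If [p] divides [n ^ 2 + 4], then [p ^ 2] cannot divide both [n ^ 2 + 4] and
   [(n + 2 * p) ^ 2 + 4]. *)
Lemma family_parameters (D : nat) : exists p n d m : nat,
  [/\ prime p, (D < p)%N, logn p d = 1%N & [/\ odd n, odd m, squarefree d,
      (d %% 8 = 5)%N & (n ^ 2 + 4 = d * m ^ 2)%N]].
Proof.
(* A prime divisor [p] of (D2!)^2 + 1 exceeds [D2] and divides [n0 ^ 2 + 4], which is four times
   that number. As [n0] is even, [n] is sought among the [n0 + k * p] with [k] odd. *)
pose D2 := D.+2; pose n0 := (2 * D2 `!)%N.
have f0 : (2 %| D2 `!)%N by apply: dvdn_fact.
pose p := pdiv ((D2 `!) ^ 2 + 1).
have N1 : (1 < (D2 `!) ^ 2 + 1)%N by have := fact_gt0 D2; nia.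
have pp : prime p by apply: pdiv_prime.
have pdvd : (p %| (D2 `!) ^ 2 + 1)%N by apply: pdiv_dvd.
have ltDp : (D2 < p)%N.
  rewrite ltnNge; apply/negP => lepD.
  have : (p %| D2 `!)%N by apply: dvdn_fact; rewrite prime_gt0.
  move=> pf; have : (p %| 1)%N.
    by move: pdvd; rewrite dvdn_addr // dvdn_exp.
  by rewrite dvdn1 => /eqP p1; rewrite p1 in pp.
have p2 : (2 < p)%N by rewrite (leq_ltn_trans _ ltDp).
have oddp : odd p by case: (even_prime pp) => // pE; move: p2; rewrite pE.
have pdvd0 : (p %| n0 ^ 2 + 4)%N.
  rewrite /n0 expnMn; have -> : (2 ^ 2 * D2`! ^ 2 + 4 = 4 * (D2 `! ^ 2 + 1))%N by lia.
  exact: dvdn_mull.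
have pn0 : ~~ (p %| n0)%N.
  apply/negP => pn; have : (p %| 4)%N.
    by move: pdvd0; rewrite dvdn_addr // dvdn_exp.
  rewrite -[4%N]/(2 ^ 2)%N Euclid_dvdX // => /andP[/dvdn_leq-/(_ isT)].
  by rewrite leqNgt p2.
have [n [oddn pn p2n]] : exists n, [/\ odd n, (p %| n ^ 2 + 4)%N
    & ~~ (p ^ 2 %| n ^ 2 + 4)%N].
  have dvdk k : (p %| (n0 + k * p) ^ 2 + 4)%N.
    have -> : ((n0 + k * p) ^ 2 + 4 = (n0 ^ 2 + 4) + (2 * n0 * k + k ^ 2 * p) * p)%N.
      by lia.
    by rewrite dvdn_add ?dvdn_mull.
  have oddk k : odd k -> odd (n0 + k * p) by rewrite oddD oddM oddM /= oddp => ->.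
  have [p1|] := boolP (p ^ 2 %| (n0 + 1 * p) ^ 2 + 4)%N; last first.
    by exists (n0 + 1 * p)%N; split=> //; exact: oddk.
  exists (n0 + 3 * p)%N; split; [exact: oddk|exact: dvdk|].
  apply/negP => p3.
  (* This is the difference of the two values; if [p ^ 2] divides it, then [p] divides [4 * n0]. *)
  have : (p ^ 2 %| 4 * n0 * p + 8 * p ^ 2)%N.
    rewrite -(dvdn_addr _ p1); suff <- : ((n0 + 3 * p) ^ 2 + 4 =
      (n0 + 1 * p) ^ 2 + 4 + (4 * n0 * p + 8 * p ^ 2))%N by [].
    by lia.
  rewrite (dvdn_addl _ (dvdn_mull 8 (dvdnn _))) -mulnn dvdn_pmul2r ?prime_gt0 // Euclid_dvdM //.
  rewrite (negPf pn0) orbF -[4%N]/(2 ^ 2)%N Euclid_dvdX // => /andP[/dvdn_leq-/(_ isT)].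
  by rewrite leqNgt p2.
have [d [m [dmE sqf]]] : exists d m, (n ^ 2 + 4 = d * m ^ 2)%N /\ squarefree d.
  by apply: squarefree_part; lia.
have oddN : odd (d * m ^ 2) by rewrite -dmE oddD oddX oddn.
move: (oddN); rewrite oddM oddX /= => /andP[oddd oddm].
have [d0 m0] : (0 < d)%N /\ (0 < m)%N by case: (d) (m) oddd oddm => [|?] [].
exists p, n, d, m; split=> //; first by rewrite /D2 in ltDp; lia.
- have : logn p (n ^ 2 + 4) = 1%N.
    apply/eqP; rewrite eqn_leq leqNgt -pfactor_dvdn ?addn_gt0 ?orbT // p2n.
    by rewrite -pfactor_dvdn ?addn_gt0 ?orbT.
  by rewrite dmE lognM ?expn_gt0 ?m0 // lognX; case: (logn p m) => [|k]; rewrite ?addn0 // mulnS addnA addnAC addn2.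
- split=> //.
  (* Odd squares are 1 modulo 8, so the equation reduces to 5 = d modulo 8. *)
  have sq8 k : odd k -> (k ^ 2 %% 8 = 1)%N.
    rewrite -modnXm; have := ltn_pmod k (isT : (0 < 8)%N).
    rewrite -(@odd_mod k 8) //.
    by case: (k %% 8)%N => [|[|[|[|[|[|[|[|?]]]]]]]].
  have := congr1 (modn^~ 8) dmE.
  by rewrite -modnDml sq8 // -modnMmr sq8 // muln1 => <-.
Qed.

(** * The fields Q(sqrt 2, sqrt d) *)

(** After clearing denominators, the two sides have [p]-adic valuations of different parity. *)
Lemma odd_logn_nonsquare (p N : nat) (q : rat) :
  odd (logn p N) -> q ^+ 2 <> N%:R.
Proof.
move=> oddN qN; have N0 : (0 < N)%N by case: N oddN {qN} => //; rewrite logn0.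
have den0 : (denq q)%:~R != 0 :> rat by rewrite intr_eq0 denq_neq0.
have : (numq q ^+ 2)%:~R = (N%:Z * denq q ^+ 2)%:~R :> rat.
  have intrX (z : int) : (z ^+ 2)%:~R = z%:~R ^+ 2 :> rat by rewrite rmorphXn.
  rewrite intrM !intrX -[N%:~R]qN -{2}(divq_num_den q).
  by rewrite expr_div_n divfK // expf_neq0.
move=> /intr_inj /(congr1 absz).
rewrite abszM !abszX /= => E.
have := congr1 (logn p) E; rewrite lognM ?expn_gt0 ?absz_gt0 ?denq_neq0 // !lognX.
by move/(congr1 odd); rewrite oddD !oddM /= oddN.
Qed.

(** The map [k] is a parameter so that one formula describes both the elements of the field and
    their images under embeddings. *)
Definition biquad_form (L : nzRingType) (k : rat -> L) (U V : L) (a b c e : rat) : L :=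
  k a + k b * U + k c * V + k e * (U * V).

(** An interface for Q(sqrt 2, sqrt d). The prime of [bq_prime] ensures that 2, d and 2d are not
    rational squares; [bq_algC] gives access to algebraic integers and to roots of quadratic
    polynomials. *)
Record biquad (d : nat) := Biquad {
  bq_field :> fieldExtType rat;
  bq_u : bq_field;
  bq_v : bq_field;
  bq_u2 : bq_u ^+ 2 = 2;
  bq_v2 : bq_v ^+ 2 = d%:R;
  bq_span : forall x, exists a b c e,
    x = biquad_form (in_alg bq_field) bq_u bq_v a b c e;
  bq_prime : exists2 p, (2 < p)%N & logn p d = 1%N;
  bq_dim : \dim {: bq_field} = 4%N;
  bq_algC : {rmorphism bq_field -> algC} }.

Section Independence.
Variables (d p : nat) (L : fieldType) (k : {rmorphism rat -> L}) (U V : L).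
Hypotheses (U2 : U ^+ 2 = 2) (V2 : V ^+ 2 = d%:R).
Hypotheses (p2 : (2 < p)%N) (pd : logn p d = 1%N).

Let knat (n : nat) : k n%:R = n%:R.
Proof. exact: rmorph_nat. Qed.

Lemma nonsquare_2_d : [/\ forall q : rat, q ^+ 2 <> 2, forall q : rat, q ^+ 2 <> d%:R
  & forall q : rat, q ^+ 2 <> 2 * d%:R].
Proof.
have d0 : (0 < d)%N by case: (d) pd => //; rewrite logn0.
split=> q.
- exact: (@odd_logn_nonsquare 2).
- by apply: (@odd_logn_nonsquare p); rewrite pd.
- rewrite -natrM; apply: (@odd_logn_nonsquare p).
  by rewrite lognM // pd logn_prime // (gtn_eqF p2).
Qed.

Lemma quad_free (a b : rat) : k a + k b * U = 0 -> a = 0 /\ b = 0.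
Proof.
have [n2 _ _] := nonsquare_2_d; have [-> /eqP|b0 E] := eqVneq b 0.
  by rewrite rmorph0 mul0r addr0 fmorph_eq0 => /eqP.
have UE : U = k (- a / b).
  rewrite fmorph_div rmorphN; apply: (mulIf (x := k b)); first by rewrite fmorph_eq0.
  rewrite divfK ?fmorph_eq0 //; apply/eqP; rewrite -subr_eq0 opprK addrC mulrC.
  by rewrite E.
case: (n2 (- a / b)); apply: (fmorph_inj k).
by rewrite rmorphXn /= -UE U2 -(knat 2).
Qed.

(** If [c + e * U] is nonzero, the relation gives [V = x + y * U] with [x], [y] rational. Squaring
    forces [x * y = 0], so that d or 2d is a rational square. *)
Lemma biquad_free (a b c e : rat) : biquad_form k U V a b c e = 0 ->
  [/\ a = 0, b = 0, c = 0 & e = 0].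
Proof.
have [n2 nd n2d] := nonsquare_2_d; rewrite /biquad_form => E.
have E' : (k a + k b * U) + (k c + k e * U) * V = 0 by rewrite -E; ring.
suff [c0 e0] : c = 0 /\ e = 0.
  move: E'; rewrite c0 e0 rmorph0 mul0r add0r mul0r addr0 => /quad_free[-> ->].
  by [].
apply/quad_free; apply/eqP; apply: contraT => ce0.
pose N := c ^+ 2 - 2 * e ^+ 2.
have kN : k N = (k c + k e * U) * (k c - k e * U).
  transitivity (k c ^+ 2 - U ^+ 2 * k e ^+ 2); last by ring.
  by rewrite U2 /N; ring.
have N0 : N != 0.
  rewrite -(fmorph_eq0 k) kN mulf_neq0 //; apply: contra ce0 => /eqP E0.
  have [c0 /eqP] : c = 0 /\ - e = 0 by apply: quad_free; rewrite rmorphN mulNr.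
  by rewrite oppr_eq0 c0 => /eqP ->; rewrite rmorph0 mul0r addr0.
(* The coordinates of -(a + bU)/(c + eU), with the denominator rationalized by the norm [N]. *)
pose x := (2 * b * e - a * c) / N; pose y := (a * e - b * c) / N.
have VE : V = k x + k y * U.
  apply: (mulfI ce0); apply: (mulIf (x := k N)); first by rewrite fmorph_eq0.
  have -> : (k c + k e * U) * V = - (k a + k b * U).
    by apply/eqP; rewrite -addr_eq0 addrC E'.
  have -> : (k c + k e * U) * (k x + k y * U) * k N =
            (k c + k e * U) * (k (x * N) + k (y * N) * U) by rewrite !rmorphM; ring.
  rewrite /x /y !divfK // kN.
  transitivity (- (k c ^+ 2 * k a + k c ^+ 2 * k b * U) + U ^+ 2 * (k a * k e ^+ 2)
    + U ^+ 2 * k b * k e ^+ 2 * U); first by ring.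
  transitivity ((k c + k e * U) * (2 * k b * k e - k a * k c) +
    (k c * (k a * k e - k b * k c) * U + U ^+ 2 * (k e * (k a * k e - k b * k c))));
    last by ring.
  by rewrite U2; ring.
clearbody x y.
have dE : k (x ^+ 2 + 2 * y ^+ 2 - d%:R) + k (2 * x * y) * U = 0.
  have -> : 0 = V ^+ 2 - d%:R by rewrite V2 subrr.
  transitivity (k x ^+ 2 + U ^+ 2 * k y ^+ 2 + 2 * k x * k y * U - k d%:R); last by rewrite VE knat; ring.
  by rewrite U2; ring.
have [dE1 /eqP] := quad_free dE; rewrite !mulf_eq0 pnatr_eq0 /= => /orP[]/eqP z0.
- by case: (n2d (2 * y)); move/eqP: dE1; rewrite z0 subr_eq0 => /eqP <-; ring.
- by case: (nd x); move/eqP: dE1; rewrite z0 subr_eq0 => /eqP <-; ring.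
Qed.

End Independence.

Section Biquad.
Variables (d p : nat).
Hypotheses (p2 : (2 < p)%N) (pd : logn p d = 1%N).

(** Take the number field generated in [algC] by the two square roots. The span of 1, u, v, uv is
    closed under products, hence is a subalgebra containing the generators, hence everything. *)
Lemma biquad_exists : inhabited (biquad d).
Proof.
have [F [iota [s sE sfull]]] := num_field_exists [:: sqrtC 2; sqrtC d%:R].
case: s sE sfull => [|u [|v []]] // [uE vE] sfull.
have u2 : u ^+ 2 = 2.
  by apply: (fmorph_inj iota); rewrite rmorphXn uE sqrtCK rmorph_nat.
have v2 : v ^+ 2 = d%:R.
  by apply: (fmorph_inj iota); rewrite rmorphXn vE sqrtCK rmorph_nat.
pose X := [tuple 1; u; v; u * v].
have formE (k : 'I_4 -> rat) : \sum_(i < 4) k i *: X`_i =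
    biquad_form (in_alg F) u v (k 0) (k 1) (k 2) (k 3).
  rewrite !big_ord_recl big_ord0 /biquad_form /= addr0 !addrA !mulr_algl.
  by congr (_ *: _ + _ *: _ + _ *: _ + _ *: _); congr k; apply: val_inj.
have freeX : free X.
  apply/freeP => k; rewrite formE => /(biquad_free u2 v2 p2 pd)[k0 k1 k2 k3] i.
  by case: i => [[|[|[|[|//]]]] lti]; [rewrite -[RHS]k0|rewrite -[RHS]k1
    |rewrite -[RHS]k2|rewrite -[RHS]k3]; congr k; apply: val_inj.
have memX x : x \in X -> x \in <<X>>%VS by exact: memv_span.
have X1 : 1 \in <<X>>%VS by apply: memX; rewrite !inE eqxx.
have closedX : (<<X>> * <<X>> <= <<X>>)%VS.
  have Xu : u \in <<X>>%VS by apply: memX; rewrite !inE eqxx ?orbT.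
  have Xv : v \in <<X>>%VS by apply: memX; rewrite !inE eqxx ?orbT.
  have Xuv : u * v \in <<X>>%VS by apply: memX; rewrite !inE eqxx ?orbT.
  have Xnat (n : nat) x : x \in <<X>>%VS -> n%:R * x \in <<X>>%VS.
    by move=> xX; rewrite mulr_natl rpredMn.
  apply/prodvP => x y xX yX; rewrite (coord_span xX) (coord_span yX).
  rewrite mulr_suml memv_suml // => i _; rewrite mulr_sumr memv_suml // => j _.
  rewrite -scalerAl -scalerAr !memvZ //.
  case: i j => [[|[|[|[|//]]]] lti] [[|[|[|[|//]]]] ltj] /=; rewrite ?mulr1 ?mul1r //.
  - by rewrite -expr2 u2 -[2]mulr1 Xnat.
  - by rewrite mulrA -expr2 u2 Xnat.
  - by rewrite mulrC.
  - by rewrite -expr2 v2 -[d%:R]mulr1 Xnat.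
  - by rewrite mulrCA -expr2 v2 mulrC Xnat.
  - by rewrite mulrAC -expr2 u2 Xnat.
  - by rewrite -mulrA -expr2 v2 mulrC Xnat.
  - by rewrite mulrACA -!expr2 u2 v2 -[2 * _]mulr1 -mulrA !Xnat.
have aX : is_aspace <<X>> by rewrite /is_aspace has_algid1.
have spanX : <<X>>%VS = fullv.
  apply/eqP; rewrite eqEsubv subvf /= -sfull.
  apply/(@Fadjoin_seqP _ _ _ _ (ASpace aX)); split; first exact: sub1v.
  by move=> x; rewrite !inE => /orP[]/eqP ->; apply: memX; rewrite !inE eqxx ?orbT.
split; refine (@Biquad d F u v u2 v2 _ _ _ iota); last 1 first.
- by rewrite -spanX; move: freeX; rewrite /free => /eqP.
- move=> x; have := coord_span (_ : x \in <<X>>%VS); rewrite spanX memvf => /(_ isT) xE.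
  by rewrite {1}xE formE; eexists; eexists; eexists; eexists.
- by exists p.
Qed.

End Biquad.

(** * Embeddings *)

Section Morphisms.
Variables (d : nat) (K : biquad d).
Notation u := (bq_u K).
Notation v := (bq_v K).
Notation formK := (biquad_form (in_alg K) u v).

Lemma bq_free a b c e : formK a b c e = 0 -> [/\ a = 0, b = 0, c = 0 & e = 0].
Proof.
by have [p p2 pd] := bq_prime K; exact: (biquad_free (k := in_alg K) (bq_u2 K) (bq_v2 K) p2 pd).
Qed.

Lemma bq_form_inj a b c e a' b' c' e' : formK a b c e = formK a' b' c' e' ->
  [/\ a = a', b = b', c = c' & e = e'].
Proof.
move=> E; have : formK (a - a') (b - b') (c - c') (e - e') = 0.
  by move/eqP: E; rewrite -subr_eq0 => /eqP <-; rewrite /biquad_form !rmorphB; ring.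
by case/bq_free => *; split; apply/eqP; rewrite -subr_eq0; apply/eqP.
Qed.

Lemma bq_formM (L : comNzRingType) (k : {rmorphism rat -> L}) (U V : L) :
  U ^+ 2 = 2 -> V ^+ 2 = d%:R -> forall a b c e a' b' c' e',
  biquad_form k U V a b c e * biquad_form k U V a' b' c' e' =
  biquad_form k U V
    (a * a' + 2 * b * b' + d%:R * c * c' + 2 * d%:R * e * e')
    (a * b' + b * a' + d%:R * c * e' + d%:R * e * c')
    (a * c' + c * a' + 2 * b * e' + 2 * e * b')
    (a * e' + e * a' + b * c' + c * b').
Proof.
move=> U2 V2 a b c e a' b' c' e'; rewrite /biquad_form.
transitivity (k a * k a' + U ^+ 2 * k b * k b' + V ^+ 2 * k c * k c' + U ^+ 2 * V ^+ 2 * k e * k e' +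
  (k a * k b' + k b * k a' + V ^+ 2 * k c * k e' + V ^+ 2 * k e * k c') * U +
  (k a * k c' + k c * k a' + U ^+ 2 * k b * k e' + U ^+ 2 * k e * k b') * V +
  (k a * k e' + k e * k a' + k b * k c' + k c * k b') * (U * V)); first by ring.
have kd : k d%:R = d%:R by rewrite rmorph_nat.
by rewrite U2 V2 -kd; ring.
Qed.

Lemma bq_morphE (L : nzRingType) (f : {rmorphism K -> L}) a b c e :
  f (formK a b c e) = biquad_form (f \o in_alg K) (f u) (f v) a b c e.
Proof. by rewrite /biquad_form !rmorphD !rmorphM. Qed.

(** The field is Q[U, V] modulo U^2 - 2 and V^2 - d, so the images of [u] and [v] can be prescribed.
    This supplies the real embeddings and the conjugations. *)
Lemma bq_morph_exists (L : fieldType) (k : {rmorphism rat -> L}) (U V : L) :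
  U ^+ 2 = 2 -> V ^+ 2 = d%:R ->
  exists f : {rmorphism K -> L}, f u = U /\ f v = V.
Proof.
move=> U2 V2.
have /choice[co coE] (x : K) : exists t : rat * rat * rat * rat,
    x = formK t.1.1.1 t.1.1.2 t.1.2 t.2.
  by have [a [b [c [e ->]]]] := bq_span x; exists (a, b, c, e).
pose f x := biquad_form k U V (co x).1.1.1 (co x).1.1.2 (co x).1.2 (co x).2.
have fE a b c e : f (formK a b c e) = biquad_form k U V a b c e.
  by rewrite /f; have [<- <- <- <-] := bq_form_inj (coE (formK a b c e)).
have fB : zmod_morphism f.
  move=> x y; rewrite (coE x) (coE y).
  move: (co x) (co y) => [[[a b] c] e] [[[a' b'] c'] e'] /=.
  transitivity (f (formK (a - a') (b - b') (c - c') (e - e'))).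
    by congr f; rewrite /biquad_form !rmorphB; ring.
  by rewrite !fE /biquad_form !rmorphB; ring.
have f1 : f 1 = 1.
  transitivity (f (formK 1 0 0 0)).
    by congr f; rewrite /biquad_form rmorph1 !rmorph0; ring.
  by rewrite fE /biquad_form rmorph1 !rmorph0; ring.
have fM : monoid_morphism f.
  split=> // x y; rewrite (coE x) (coE y) (bq_formM _ (bq_u2 K) (bq_v2 K)).
  by rewrite !fE (bq_formM _ U2 V2).
pose mB := GRing.isZmodMorphism.Build _ _ f fB.
pose mM := GRing.isMonoidMorphism.Build _ _ f fM.
pose F : {rmorphism K -> L} := HB.pack f mB mM.
exists F; split.
- transitivity (f (formK 0 1 0 0)).
    by congr f; rewrite /biquad_form rmorph1 !rmorph0; ring.
  by rewrite fE /biquad_form rmorph1 !rmorph0; ring.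
- transitivity (f (formK 0 0 1 0)).
    by congr f; rewrite /biquad_form rmorph1 !rmorph0; ring.
  by rewrite fE /biquad_form rmorph1 !rmorph0; ring.
Qed.

(** If the square of a + bu + cv + euv is rational, only one coordinate is nonzero, so [N] is a^2,
    2b^2, dc^2 or 2de^2. Each is excluded by the parity of valuations at [p], which divides neither
    2 nor d. This is what tells the fields apart. *)
Lemma bq_no_sqrt (p N : nat) (w : K) : (2 < p)%N -> logn p d = 0%N ->
  logn p N = 1%N -> w ^+ 2 <> N%:R.
Proof.
move=> p2 pd pN wN; have [a [b [c [e wE]]]] := bq_span w.
have d0 : (0 < d)%N by have [q _] := bq_prime K; case: (d) => //; rewrite logn0.
have N0 : (0 < N)%N by case: (N) pN => //; rewrite logn0.
have p_2 : logn p 2 = 0%N by rewrite logn_prime // (gtn_eqF p2).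
have nsq (t : nat) (q : rat) : (0 < t)%N -> logn p t = 0%N -> q ^+ 2 <> (t * N)%:R.
  by move=> t0 pt; apply: (@odd_logn_nonsquare p); rewrite lognM // pt pN.
have [q2 qd qu] : [/\ forall q : rat, q ^+ 2 <> 2 , forall q : rat, q ^+ 2 <> d%:R
    & forall q : rat, q ^+ 2 <> 2 * d%:R].
  by have [q] := bq_prime K; exact: nonsquare_2_d.
have dq0 : d%:R != 0 :> rat by rewrite pnatr_eq0 -lt0n.
have : formK (a * a + 2 * b * b + d%:R * c * c + 2 * d%:R * e * e)
    (a * b + b * a + d%:R * c * e + d%:R * e * c)
    (a * c + c * a + 2 * b * e + 2 * e * b)
    (a * e + e * a + b * c + c * b) = formK N%:R 0 0 0.
  rewrite -(bq_formM _ (bq_u2 K) (bq_v2 K)) -wE -expr2 wN /biquad_form.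
  by rewrite !rmorph0 rmorph_nat; ring.
case/bq_form_inj => E0 E1 E2 E3.
have ab : a * b = - (d%:R * c * e) by lra.
have ac : a * c = - (2 * b * e) by lra.
have ae : a * e = - (b * c) by lra.
have [a0|a0] := eqVneq a 0; last first.
  have e0 : e = 0.
    apply/eqP; apply: contraT => e0.
    (* Eliminating [a] between [ab] and [ac] gives dc^2 = 2b^2 when [e] is nonzero, and then 2d is
       the square of dc/b. *)
    have /eqP : e * (d%:R * c ^+ 2 - 2 * b ^+ 2) = 0.
      transitivity (b * (a * c) - c * (a * b)); last by ring.
      by rewrite ab ac; ring.
    rewrite mulf_eq0 (negPf e0) subr_eq0 /= => /eqP E.
    have [b0|b0] := eqVneq b 0.
      by move/eqP: ae; rewrite b0 mul0r oppr0 mulf_eq0 (negPf a0) (negPf e0).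
    case: (qu (d%:R * c / b)); rewrite expr_div_n exprMn.
    apply: (mulIf (x := b ^+ 2)); rewrite ?expf_neq0 // divfK ?expf_neq0 //.
    by rewrite expr2 -mulrA E; ring.
  have b0 : b = 0.
    by move/eqP: ab; rewrite e0 mulr0 oppr0 mulf_eq0 (negPf a0) => /eqP.
  have c0 : c = 0.
    by move/eqP: ac; rewrite e0 mulr0 oppr0 mulf_eq0 (negPf a0) => /eqP.
  by case: (@nsq 1 a) => //; rewrite ?logn1 // mul1n -E0 b0 c0 e0; ring.
move: ab ac ae; rewrite a0 !mul0r => /eqP ab /eqP ac /eqP ae.
rewrite eq_sym oppr_eq0 -mulrA mulf_eq0 (negPf dq0) mulf_eq0 /= in ab.
rewrite eq_sym oppr_eq0 -mulrA mulf_eq0 pnatr_eq0 mulf_eq0 /= in ac.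
rewrite eq_sym oppr_eq0 mulf_eq0 in ae.
have [b0|b0] := eqVneq b 0; last first.
  rewrite (negPf b0) in ac ae; case: (@nsq 2 (2 * b)) => //.
  by rewrite natrM -E0 a0 (eqP ac) (eqP ae); ring.
have [c0|c0] := eqVneq c 0; last first.
  rewrite (negPf c0) in ab; case: (@nsq d (d%:R * c)) => //.
  by rewrite natrM -E0 a0 b0 (eqP ab); ring.
case: (@nsq (2 * d)%N (2 * d%:R * e)); rewrite ?muln_gt0 ?d0 ?lognM ?p_2 ?pd //.
by rewrite natrM -E0 a0 b0 c0 natrM; ring.
Qed.

End Morphisms.

Lemma bq_sqr_cases (L : fieldType) (z c : L) : z ^+ 2 = c ^+ 2 ->
  exists b : bool, z = (-1) ^+ b * c.
Proof.
move/eqP; rewrite eqf_sqr => /orP[]/eqP ->; first by exists false; rewrite mul1r.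
by exists true; rewrite mulN1r.
Qed.

Section RealEmbeddings.
Variables (R : realType) (d : nat) (K : biquad d).
Notation u := (bq_u K).
Notation v := (bq_v K).
Notation r2 := (Num.sqrt 2 : R).
Notation rd := (Num.sqrt d%:R : R).

(** The images of [u] and [v] have squares 2 and d, hence are real. *)
Lemma bq_totally_real : totally_real R K.
Proof.
move=> f x; have [a [b [c [e ->]]]] := bq_span x; rewrite bq_morphE.
have fu : f u ^+ 2 = (real_complex R r2) ^+ 2.
  by rewrite -!rmorphXn bq_u2 sqr_sqrtr // !rmorph_nat.
have fv : f v ^+ 2 = (real_complex R rd) ^+ 2.
  by rewrite -!rmorphXn bq_v2 sqr_sqrtr // !rmorph_nat.
have [b1 ->] := bq_sqr_cases fu; have [b2 ->] := bq_sqr_cases fv.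
have fk q : (f \o in_alg K) q = real_complex R (ratr q).
  by rewrite fmorph_eq_rat -(fmorph_eq_rat (real_complex R \o ratr)).
suff -> : biquad_form (f \o in_alg K) ((-1) ^+ b1 * real_complex R r2)
    ((-1) ^+ b2 * real_complex R rd) a b c e =
  real_complex R (biquad_form ratr ((-1) ^+ b1 * r2) ((-1) ^+ b2 * rd) a b c e) by [].
by rewrite /biquad_form !fk !(rmorphD, rmorphM, rmorph_sign).
Qed.

(** The two binary digits of the index are the signs: the parity of [m] for sqrt 2, and [1 < m] for
    sqrt d. *)
Lemma bq_real_embeddings : exists sigma : 'I_4 -> {rmorphism K -> R},
  real_embeddings sigma /\ forall m, sigma m u = (-1) ^+ odd m * r2 /\
                                     sigma m v = (-1) ^+ (1 < m)%N * rd.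
Proof.
have /choice[sigma sE] (m : 'I_4) : exists f : {rmorphism K -> R},
    f u = (-1) ^+ odd m * r2 /\ f v = (-1) ^+ (1 < m)%N * rd.
  apply: (@bq_morph_exists d K R ratr); rewrite exprMn sqrr_sign mul1r sqr_sqrtr //.
have d0 : (0 < d)%N by have [q _] := bq_prime K; case: (d) => //; rewrite logn0.
have sgn_inj (b b' : bool) (c : R) : 0 < c -> (-1) ^+ b * c = (-1) ^+ b' * c -> b = b'.
  by case: b b' => [] []; rewrite ?expr1 ?expr0 // => c0; lra.
exists sigma; split=> //; split=> [l m slm|f].
  have [lu lv] := sE l; have [mu mv] := sE m.
  have /sgn_inj E1 : (-1) ^+ odd l * r2 = (-1) ^+ odd m * r2 by rewrite -lu -mu slm.
  have /sgn_inj E2 : (-1) ^+ (1 < l)%N * rd = (-1) ^+ (1 < m)%N * rd by rewrite -lv -mv slm.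
  move: E1 E2; rewrite !sqrtr_gt0 ltr0n ltr0n => /(_ isT) + /(_ d0).
  by case: l m {slm lu lv mu mv} => [[|[|[|[|//]]]] ?] [[|[|[|[|//]]]] ?] //= _ _; apply: val_inj.
have fu : f u ^+ 2 = r2 ^+ 2 by rewrite -rmorphXn bq_u2 sqr_sqrtr // rmorph_nat.
have fv : f v ^+ 2 = rd ^+ 2 by rewrite -rmorphXn bq_v2 sqr_sqrtr // rmorph_nat.
have [b1 E1] := bq_sqr_cases fu; have [b2 E2] := bq_sqr_cases fv.
have lt4 : (b1 + b2.*2 < 4)%N by case: (b1) (b2) => [] [].
exists (Ordinal lt4) => x; have [a [b [c [e ->]]]] := bq_span x; rewrite !bq_morphE.
have [-> ->] := sE (Ordinal lt4).
by rewrite E1 E2 /biquad_form !fmorph_eq_rat; case: b1 b2 {E1 E2} lt4 => [] [].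
Qed.

End RealEmbeddings.

(** * The ring of integers *)

(** The square of the denominator of [q] is coprime to its numerator, so it divides d and must be
    1. *)
Lemma squarefree_int (d : nat) (q : rat) : squarefree d ->
  d%:R * q ^+ 2 \is a Num.int -> q \is a Num.int.
Proof.
move=> sqf /intrP[M ME].
have den0 : (denq q)%:~R != 0 :> rat by rewrite intr_eq0 denq_neq0.
have intrX (z : int) : (z ^+ 2)%:~R = z%:~R ^+ 2 :> rat by rewrite rmorphXn.
have : (d%:Z * numq q ^+ 2)%:~R = (M * denq q ^+ 2)%:~R :> rat.
  rewrite [LHS]intrM [RHS]intrM !intrX -ME -mulrA -exprMn.
  by rewrite -{2}(divq_num_den q) divfK.
move=> /intr_inj /(congr1 absz); rewrite abszM [X in _ = X -> _]abszM !abszX /= => E.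
have : (`|denq q| ^ 2 %| d)%N.
  have cop : coprime (`|denq q| ^ 2) (`|numq q| ^ 2).
    by rewrite coprimeXl // coprimeXr // coprime_sym coprime_num_den.
  by rewrite -(Gauss_dvdl _ cop) E; apply: dvdn_mull.
move=> den_d; suff den1 : `|denq q|%N = 1%N.
  have := absz_denq q; rewrite den1 => /esym den1'.
  by apply/intrP; exists (numq q); rewrite -{1}(divq_num_den q) den1' divr1.
apply/eqP; rewrite eqn_leq absz_gt0 denq_neq0 andbT leqNgt; apply/negP => den_gt1.
have := sqf _ (pdiv_prime den_gt1); rewrite (dvdn_trans _ den_d) //.
by rewrite dvdn_exp2r // pdiv_dvd.
Qed.

Lemma int_sqr_even (z w : int) : z ^+ 2 = 2 * w -> exists y, z = 2 * y.
Proof.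
move=> E; have [q [b zE]] : exists (q : int) (b : bool), z = 2 * q + b%:Z.
  by exists (z %/ 2)%Z, (z %% 2 == 1)%Z; case: eqP; lia.
by exists q; case: b zE => /= zE; [move: E; rewrite zE; lia|rewrite zE addr0].
Qed.

Section Integers.
Variables (d : nat) (K : biquad d).
Hypotheses (sqf : squarefree d) (d8 : (d %% 8 = 5)%N).
Notation u := (bq_u K).
Notation v := (bq_v K).
Notation formK := (biquad_form (in_alg K) u v).
Definition bq_omega := (1 + v) / 2.
Notation w := bq_omega.
Definition is_int (L : nzRingType) (x : L) := integralOver (intr : int -> L) x.

Lemma is_int_morph (L L' : nzRingType) (f : {rmorphism L -> L'}) x :
  is_int x -> is_int (f x).
Proof.
move=> /(integral_rmorph f); congr (integralOver _ _).
by apply/funext => z /=; rewrite rmorph_int.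
Qed.

Lemma bq_is_int_rat (q : rat) : is_int (in_alg K q) -> q \is a Num.int.
Proof.
move=> /(is_int_morph (bq_algC K)) [p pmon proot].
have : bq_algC K (in_alg K q) \in Aint.
  apply: (root_monic_Aint proot); first exact: monic_map.
  by apply/polyOverP => i; rewrite coef_map /=; apply: intr_int.
have -> : bq_algC K (in_alg K q) = ratr q.
  exact: (fmorph_eq_rat (bq_algC K \o in_alg K)).
move/(Cint_rat_Aint (Crat_rat q)) => /intrP[z zE]; apply/intrP; exists z.
by apply: (fmorph_inj (ratr : rat -> algC)); rewrite /= ratr_int.
Qed.

Lemma bq_natr_neq0 n : (0 < n)%N -> n%:R != 0 :> K.
Proof. by move=> n0; rewrite -(rmorph_nat (in_alg K)) fmorph_eq0 pnatr_eq0 -lt0n. Qed.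

Lemma bq_is_int_u : is_int u.
Proof.
exists ('X^2 - 2%:P); first by rewrite monicXnsubC.
by rewrite rmorphB /= map_polyXn map_polyC /= /root !hornerE bq_u2 subrr.
Qed.

Lemma bq_is_int_omega : is_int w.
Proof.
(* Here [k] is (d - 1)/4, and [w] is a root of X^2 - X - k. *)
pose k := (d %/ 4)%N; have dE : d = (4 * k + 1)%N by rewrite /k; lia.
exists ('X^2 - 'X - k%:Z%:P).
  rewrite -addrA -opprD monicE lead_coefDl ?lead_coefXn // size_polyXn size_polyN.
  by rewrite (leq_ltn_trans (size_polyD _ _)) // size_polyX size_polyC; case: (_ == _).
rewrite !rmorphB /= map_polyXn map_polyX map_polyC /= /root !hornerE /w.
have v2 : v ^+ 2 = 4 * k%:R + 1.
  by rewrite bq_v2 -natrM -[1]/(1%:R) -natrD; congr _%:R.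
have n2 := bq_natr_neq0 (isT : (0 < 2)%N).
apply/eqP; transitivity ((v ^+ 2 - 4 * k%:R - 1) / 4); last first.
  by rewrite v2 (_ : _ - _ - 1 = 0) ?mul0r //; ring.
by field; rewrite ?n2 ?bq_natr_neq0.
Qed.

Lemma bq_formD a b c e a' b' c' e' : formK a b c e + formK a' b' c' e' =
  formK (a + a') (b + b') (c + c') (e + e').
Proof. by rewrite /biquad_form !rmorphD; ring. Qed.

Lemma bq_conj_u : exists f : {rmorphism K -> K}, forall a b c e,
  f (formK a b c e) = formK a (- b) c (- e).
Proof.
have [||f [fu fv]] := @bq_morph_exists d K K (in_alg K) (- u) v.
- by rewrite sqrrN bq_u2.
- exact: bq_v2.
exists f => a b c e; rewrite bq_morphE fu fv /biquad_form !rmorphN.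
by rewrite !(fmorph_eq_rat (f \o in_alg K)) !(fmorph_eq_rat (in_alg K)); ring.
Qed.

Lemma bq_conj_v : exists f : {rmorphism K -> K}, forall a b c e,
  f (formK a b c e) = formK a b (- c) (- e).
Proof.
have [||f [fu fv]] := @bq_morph_exists d K K (in_alg K) u (- v).
- exact: bq_u2.
- by rewrite sqrrN bq_v2.
exists f => a b c e; rewrite bq_morphE fu fv /biquad_form !rmorphN.
by rewrite !(fmorph_eq_rat (f \o in_alg K)) !(fmorph_eq_rat (in_alg K)); ring.
Qed.

Lemma bq_form_rat a : formK a 0 0 0 = in_alg K a.
Proof. by rewrite /biquad_form !rmorph0; ring. Qed.

(** The trace P = 2a and the norm N = a^2 - 2b^2 are integers, so (4b)^2 = 2P^2 - 8N. This makes 4b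
    an integer, and parity, applied in turn to 4b, P and 2b, removes the remaining factors 2. *)
Lemma bq_int_sqrt2 a b : is_int (formK a b 0 0) ->
  a \is a Num.int /\ b \is a Num.int.
Proof.
move=> xint; have [f fE] := bq_conj_u; have := is_int_morph f xint.
rewrite fE oppr0 => yint.
have := integral_add xint yint; rewrite bq_formD !addr0 subrr bq_form_rat.
move/bq_is_int_rat => /intrP[P PE].
have := integral_mul xint yint; rewrite (bq_formM _ (bq_u2 K) (bq_v2 K)).
rewrite (_ : biquad_form _ _ _ _ _ _ _ = in_alg K (a ^+ 2 - 2 * b ^+ 2)); last first.
  by rewrite -bq_form_rat; congr biquad_form; ring.
move/bq_is_int_rat => /intrP[N NE].
have /intrP[Q QE] : 4 * b \is a Num.int.
  apply: (@squarefree_int 1) => [r pr|].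
    by rewrite dvdn1 -mulnn; case: r pr => [|[|r]].
  apply/intrP; exists (2 * P ^+ 2 - 8 * N).
  transitivity (2 * P%:~R ^+ 2 - 8 * N%:~R : rat); last by ring.
  by rewrite -PE -NE; ring.
have QPN : Q ^+ 2 = 2 * (P ^+ 2 - 4 * N).
  apply: (intr_inj (R := rat)).
  transitivity (Q%:~R ^+ 2 : rat); first by ring.
  transitivity (2 * (P%:~R ^+ 2 - 4 * N%:~R) : rat); last by ring.
  by rewrite -PE -NE -QE; ring.
have [Q1 Q1E] := int_sqr_even QPN.
have [P1 P1E] : exists P1, P = 2 * P1.
  by apply: (@int_sqr_even _ (2 * N + Q1 ^+ 2)); move: QPN; rewrite Q1E; lia.
have [Q2 Q2E] : exists Q2, Q1 = 2 * Q2.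
  by apply: (@int_sqr_even _ (P1 ^+ 2 - N)); move: QPN; rewrite Q1E P1E; lia.
split; apply/intrP; [exists P1|exists Q2].
  by move: PE; rewrite P1E rmorphM /=; lra.
by move: QE; rewrite Q1E Q2E !rmorphM /=; lra.
Qed.

(** With trace P = 2a and norm N, d(2c)^2 = P^2 - 4N is an integer, and d is squarefree. *)
Lemma bq_int_sqrtd a c : is_int (formK a 0 c 0) ->
  2 * a \is a Num.int /\ 2 * c \is a Num.int.
Proof.
move=> xint; have [f fE] := bq_conj_v; have := is_int_morph f xint.
rewrite fE oppr0 => yint.
have := integral_add xint yint; rewrite bq_formD !addr0 subrr bq_form_rat.
have -> : a + a = 2 * a by ring.
move/bq_is_int_rat => aint; split=> //.
have /intrP[P PE] := aint.
have := integral_mul xint yint; rewrite (bq_formM _ (bq_u2 K) (bq_v2 K)).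
rewrite (_ : biquad_form _ _ _ _ _ _ _ = in_alg K (a ^+ 2 - d%:R * c ^+ 2)); last first.
  by rewrite -bq_form_rat; congr biquad_form; ring.
move/bq_is_int_rat => /intrP[N NE].
apply: (squarefree_int sqf); apply/intrP; exists (P ^+ 2 - 4 * N).
transitivity (P%:~R ^+ 2 - 4 * N%:~R : rat); last by ring.
by rewrite -PE -NE; ring.
Qed.

(* An integer [x] is recovered from its traces to the two quadratic subfields:
   those of [x] and [x * bq_omega] bound its denominators at [d], those of [x]
   and [x * u] at 2. *)
Lemma ring_of_integersP (x : K) : ring_of_integers x <->
  exists g0 h0 g1 h1 : int, x = (g0%:~R + h0%:~R * u) + (g1%:~R + h1%:~R * u) * w.
Proof.
rewrite /ring_of_integers /=; split=> [xint|[g0 [h0 [g1 [h1 ->]]]]]; last first.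
  have zint (z : int) : is_int (z%:~R : K) by exact: (integral_id (intr : int -> K)).
  apply: integral_add; last apply: integral_mul; last exact: bq_is_int_omega.
    by apply: integral_add; [|apply: integral_mul]; (exact: zint || exact: bq_is_int_u).
  by apply: integral_add; [|apply: integral_mul]; (exact: zint || exact: bq_is_int_u).
have [a [b [c [e xE]]]] := bq_span x; rewrite -/(is_int _) in xint.
have [f fE] := bq_conj_u; have [g gE] := bq_conj_v.
have uE : u = formK 0 1 0 0 by rewrite /biquad_form rmorph1 !rmorph0; ring.
have wE : w = formK (1/2) 0 (1/2) 0.
  by rewrite /biquad_form /w fmorph_div rmorph1 rmorph_nat !rmorph0; ring.
have := integral_add xint (is_int_morph g xint).
rewrite {2}xE {1}xE gE bq_formD !subrr => /bq_int_sqrt2[/intrP[z1 E1] /intrP[z2 E2]].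
have xw := integral_mul xint bq_is_int_omega.
have xwE : x * w = formK ((a + d%:R * c) / 2) ((b + d%:R * e) / 2) ((a + c) / 2) ((b + e) / 2).
  by rewrite wE xE (bq_formM _ (bq_u2 K) (bq_v2 K)); congr biquad_form; field.
have := integral_add xw (is_int_morph g xw).
rewrite xwE gE bq_formD !subrr => /bq_int_sqrt2[/intrP[z3 E3] /intrP[z4 E4]].
have := integral_add xint (is_int_morph f xint).
rewrite {2}xE {1}xE fE bq_formD !subrr => /bq_int_sqrtd[_ /intrP[z5 E5]].
have xu := integral_mul xint bq_is_int_u.
have xuE : x * u = formK (2 * b) a (2 * e) c.
  by rewrite xE [X in _ * X = _]uE (bq_formM _ (bq_u2 K) (bq_v2 K)); congr biquad_form; ring.
have := integral_add xu (is_int_morph f xu).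
rewrite xuE fE bq_formD !subrr => /bq_int_sqrtd[_ /intrP[z6 E6]].
pose k : int := (d %/ 8)%N; have dE : d%:R = 8 * k%:~R + 5 :> rat.
  by rewrite {1}(divn_eq d 8) d8 natrD natrM mulrC.
rewrite dE in E3 E4.
(* These are 2c and 2e. The integers 2dc and 4c give 2c = 2dc - (4k + 2)4c; the integers 2de and 8e
   give 2e because 5 inverts d modulo 8: 5d = 8(5k + 3) + 1. *)
pose c2 := 2 * z3 - z1 - (4 * k + 2) * z5.
pose e2 := 5 * (2 * z4 - z2) - 2 * (3 + 5 * k) * z6.
have c2E : 2 * c = c2%:~R.
  by rewrite /c2 !(rmorphB, rmorphM, rmorphD) /= -E1 -E3 -E5; field.
have e2E : 2 * e = e2%:~R.
  by rewrite /e2 !(rmorphB, rmorphM, rmorphD) /= -E2 -E4 -E6; field.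
clearbody c2 e2.
(* From a + cv = (a - c) + 2cw, where a - c = (a + dc) - (d + 1)c and d + 1 = 2(4k + 3). *)
exists (z3 - (4 * k + 3) * c2), (z4 - (4 * k + 3) * e2), c2, e2.
have -> : x = formK (a - c) (b - e) 0 0 + formK (2 * c) (2 * e) 0 0 * w.
  rewrite wE (bq_formM _ (bq_u2 K) (bq_v2 K)) bq_formD xE.
  by congr biquad_form; field.
rewrite c2E e2E.
have -> : a - c = (z3 - (4 * k + 3) * c2)%:~R.
  by rewrite !(rmorphB, rmorphM, rmorphD) /= -E3 -c2E; field.
have -> : b - e = (z4 - (4 * k + 3) * e2)%:~R.
  by rewrite !(rmorphB, rmorphM, rmorphD) /= -E4 -e2E; field.
by rewrite /biquad_form !rmorph0 !rmorph_int; ring.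
Qed.
End Integers.

(** * Orders *)

Local Open Scope classical_set_scope.

Lemma char_poly_int (L : fieldType) (n : nat) (A : 'M[L]_n) :
  (forall i j, is_int (A i j)) -> forall l, is_int (char_poly A)`_l.
Proof.
move=> Aint; pose P (p : {poly L}) := forall l, is_int p`_l.
have P0 : P 0 by move=> l; rewrite coef0; exact: (integral0 (intr : int -> L)).
have PC c : is_int c -> P c%:P.
  move=> cint l; rewrite coefC; case: eqP => // _.
  exact: (integral0 (intr : int -> L)).
have P1 : P 1 by apply: PC; exact: (integral1 (intr : int -> L)).
have PX : P 'X.
  by move=> l; rewrite coefX; exact: (integral_nat (intr : int -> L)).
have PD p q : P p -> P q -> P (p + q).
  by move=> Pp Pq l; rewrite coefD; apply: integral_add; [exact: Pp|exact: Pq].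
have PM p q : P p -> P q -> P (p * q).
  move=> Pp Pq l; rewrite coefM; elim/big_ind: _ => [||i _].
  - exact: (integral0 (intr : int -> L)).
  - by move=> ? ?; exact: integral_add.
  - by apply: integral_mul; [exact: Pp|exact: Pq].
have PN p : P p -> P (- p).
  by move=> Pp l; rewrite coefN; apply: integral_opp; exact: Pp.
rewrite -/(P _) /char_poly /determinant.
elim/big_ind: _ => // s _; apply: (PM).
  by case: (perm.odd_perm s); rewrite ?expr1 ?expr0; [exact: PN|].
elim/big_ind: _ => // i _; rewrite !mxE; apply: PD; last exact/PN/PC.
by case: (_ == _); rewrite ?mulr1n ?mulr0n.
Qed.

Section Orders.
Variables (F L : fieldType) (f : {rmorphism F -> L}).

Definition quat_map (x : quat F) : quat L :=
  Quat (f (q1 x)) (f (qi x)) (f (qj x)) (f (qk x)).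

Lemma quat_mapD x y : quat_map (x + y) = quat_map x + quat_map y.
Proof. by case: x y => [????] [????]; congr Quat; rewrite /= rmorphD. Qed.

Lemma quat_mapM x y : quat_map (x * y) = quat_map x * quat_map y.
Proof. by case: x y => [????] [????]; congr Quat => /=; ring. Qed.

Lemma quat_mapZ c x : quat_map (c *: x) = f c *: quat_map x.
Proof. by case: x => [????]; congr Quat; rewrite /= rmorphM. Qed.

Lemma quat_map0 : quat_map 0 = 0.
Proof. by congr Quat => /=; rewrite rmorph0. Qed.

Lemma quat_map1 : quat_map 1 = 1.
Proof. by congr Quat => /=; rewrite ?rmorph0 ?rmorph1. Qed.

Lemma quat_map_sum n (x : 'I_n -> quat F) :
  quat_map (\sum_l x l) = \sum_l quat_map (x l).
Proof. by rewrite (big_morph _ quat_mapD quat_map0). Qed.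

Definition quat_coord (K : fieldType) (i : 'I_4) (x : quat K) : K :=
  (quat_to_seq x)`_i.

Lemma quat_coordD (K : fieldType) i : {morph @quat_coord K i : x y / x + y}.
Proof. by case: i => [[|[|[|[|//]]]] ?] [????] [????]. Qed.

Lemma quat_coordZ (K : fieldType) i c x :
  @quat_coord K i (c *: x) = c * quat_coord i x.
Proof. by case: i x => [[|[|[|[|//]]]] ?] [????]. Qed.

Lemma quat_coord0 (K : fieldType) i : @quat_coord K i 0 = 0.
Proof. by case: i => [[|[|[|[|//]]]] ?]. Qed.

Lemma quat_coord_sum (K : fieldType) i n (x : 'I_n -> quat K) :
  quat_coord i (\sum_l x l) = \sum_l quat_coord i (x l).
Proof. by rewrite (big_morph _ (quat_coordD i) (quat_coord0 K i)). Qed.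

Lemma quat_coord_eq0 (K : fieldType) (x : quat K) :
  (forall i, quat_coord i x = 0) -> x = 0.
Proof.
case: x => x y z t x0; have := (x0 0, x0 1, x0 2, x0 3).
by rewrite /quat_coord /= => -[[[-> ->] ->] ->].
Qed.

(* [psi u := coord (W * u)], with [W * z = lam *: W], turns left
   multiplication by [z] on the generators [b] into an eigenvector of [C]. *)
Lemma quat_root_int n (b : 'I_n -> quat F) (e : 'I_n -> F) (C : 'I_n -> 'I_n -> F)
    (z : quat F) (lam lam' : L) :
  1 = \sum_l e l *: b l -> (forall l m, is_int (C l m)) ->
  (forall l, z * b l = \sum_m C l m *: b m) ->
  lam + lam' = f (2 * q1 z) ->
  lam * lam' = f (q1 z ^+ 2 + qi z ^+ 2 + qj z ^+ 2 + qk z ^+ 2) ->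
  is_int lam.
Proof.
move=> b1 Cint zb trE nrE.
(* The quadratic equation of [z] reads (z - lam')z = lam(z - lam'), so [W = z - lam'] works unless
   it vanishes; in that case [z] is the scalar [lam = lam'] and [W = 1] works. *)
have [W W0 Wz] : exists2 W : quat L, W <> 0 & W * quat_map z = lam *: W.
  have [z0|z0] := pselect (quat_map z = Quat lam' 0 0 0).
    have llE : lam = lam'.
      have : f (q1 z) = lam' by case: z0.
      by move=> q1E; move: trE; have -> : f (2 * q1 z) = lam' + lam';
        [rewrite -q1E; ring | move/addIr].
    exists 1; first by case=> /eqP; rewrite oner_eq0.
    by rewrite z0 -llE; congr Quat => /=; ring.
  exists (quat_map z - Quat lam' 0 0 0).
    by move/eqP; rewrite subr_eq0 => /eqP.
  case: z trE nrE {zb z0} => x y w t /= trE nrE.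
  have trE' : lam = 2 * f x - lam'.
    by apply/eqP; rewrite eq_sym subr_eq trE; apply/eqP; ring.
  have nrE' : (2 * f x - lam') * lam' = f x ^+ 2 + f y ^+ 2 + f w ^+ 2 + f t ^+ 2.
    by rewrite -trE' nrE; ring.
  rewrite trE'; congr Quat => /=; [|by ring|by ring|by ring].
  transitivity ((2 * f x - lam') * f x - ((2 * f x - lam') * lam')); last by ring.
  by rewrite nrE'; ring.
pose A := (\matrix_(l, m) f (C l m))^T.
(* The eigenvector must not vanish: 1 is a combination of the [b l], so if every [W * b l] were
   zero, [W] would be too. *)
have [l0 [i Wl0]] : exists l i, quat_coord i (W * quat_map (b l)) != 0.
  apply: contrapT => H; apply: W0; rewrite -[W]mulr1 -quat_map1 b1 quat_map_sum.
  rewrite mulr_sumr big1 // => l _; rewrite quat_mapZ -scalerAr.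
  suff -> : W * quat_map (b l) = 0 by rewrite scaler0.
  apply: quat_coord_eq0 => i; apply/eqP; apply: contraT => nz.
  by case: H; exists l, i.
have eigA : eigenvalue A lam.
  apply/eigenvalueP; exists (\row_l quat_coord i (W * quat_map (b l))).
    apply/rowP => l; rewrite !mxE -quat_coordZ scalerAl -Wz -mulrA -quat_mapM zb.
    rewrite quat_map_sum mulr_sumr quat_coord_sum; apply: eq_bigr => m _.
    by rewrite !mxE quat_mapZ -scalerAr quat_coordZ mulrC.
  by apply/eqP => /rowP/(_ l0); rewrite !mxE => /eqP; exact/negP.
apply: (@integral_root_monic _ _ (intr : int -> L) lam (char_poly A)).
- exact: char_poly_monic.
- by rewrite -eigenvalue_root_char.
- by apply/integral_poly; apply: char_poly_int => l m; rewrite !mxE; apply: is_int_morph.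
Qed.

End Orders.

(** The reduced trace is the sum of the two roots in [algC] of the reduced characteristic
    polynomial, and [quat_root_int] applies to each root. *)
Lemma order_trace_int (F : fieldExtType rat) (iota : {rmorphism F -> algC})
    (O : set (quat F)) (z : quat F) : is_order O -> O z -> is_int (2 * q1 z).
Proof.
move=> [[O1 _ OM] [n [b OE]] _] Oz.
have Ob l : O (b l).
  rewrite OE; exists (fun m => (m == l)%:R).
    by move=> m; exact: (integral_nat (intr : int -> F)).
  by rewrite (bigD1 l) //= eqxx scale1r big1 ?addr0 // => m /negPf ->; rewrite scale0r.
have : O 1 by have := O1; rewrite inE.
rewrite OE => -[e _ b1].
have /choice[C CE] l : exists c : 'I_n -> F,
    (forall m, ring_of_integers (c m)) /\ z * b l = \sum_m c m *: b m.
  have : O (z * b l).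
    by have := OM z (b l); rewrite !inE; apply; rewrite ?inE.
  by rewrite OE => -[c cint ->]; exists c.
pose t := iota (2 * q1 z).
pose N := iota (q1 z ^+ 2 + qi z ^+ 2 + qj z ^+ 2 + qk z ^+ 2).
pose r := sqrtC (t ^+ 2 - 4 * N).
have rE : r ^+ 2 = t ^+ 2 - 4 * N by rewrite sqrtCK.
pose l1 := (t + r) / 2; pose l2 := (t - r) / 2.
have trE : l1 + l2 = t by rewrite /l1 /l2; field.
have nrE : l1 * l2 = N.
  transitivity ((t ^+ 2 - r ^+ 2) / 4); first by rewrite /l1 /l2; field.
  by rewrite rE; field.
have Cint l m : is_int (C l m) by have [cint _] := CE l; exact: cint.
have zb l : z * b l = \sum_m C l m *: b m by case: (CE l).
have int1 := quat_root_int b1 Cint zb trE nrE.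
rewrite addrC in trE; rewrite mulrC in nrE.
have int2 := quat_root_int b1 Cint zb trE nrE.
have := integral_add int2 int1; rewrite trE => -[p pmon proot].
(* As [iota] is injective, the monic polynomial found in [algC] already annihilates the trace in
   [F]. *)
exists p => //; rewrite -(fmorph_root iota) -map_poly_comp.
by rewrite (eq_map_poly (rmorph_int iota)).
Qed.

(** * A self-dual order of the quaternion algebra *)

Section MaximalOrder.
Variables (d : nat) (K : biquad d).
Notation u := (bq_u K).

(** The entry [u / 2] is 1/sqrt 2, so all four elements have reduced norm 1. *)
Definition basisO : 4.-tuple (quat K) :=
  [tuple 1; Quat (u / 2) (u / 2) 0 0; Quat (u / 2) 0 (u / 2) 0;
    Quat (1 / 2) (1 / 2) (1 / 2) (1 / 2)].

Definition orderO : set (quat K) := [set x | exists2 c : 'I_4 -> K,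
  forall l, ring_of_integers (c l) & x = \sum_l c l *: tnth basisO l].

Definition combO (c0 c1 c2 c3 : K) : quat K :=
  Quat (c0 + c1 * (u / 2) + c2 * (u / 2) + c3 / 2) (c1 * (u / 2) + c3 / 2)
    (c2 * (u / 2) + c3 / 2) (c3 / 2).

Lemma sum_basisO (c : 'I_4 -> K) :
  \sum_l c l *: tnth basisO l = combO (c 0) (c 1) (c 2) (c 3).
Proof.
rewrite !big_ord_recl big_ord0 !(tnth_nth 0) /= /combO.
have -> : lift ord0 ord0 = 1 :> 'I_4 by apply: val_inj.
have -> : lift ord0 (lift ord0 ord0) = 2 :> 'I_4 by apply: val_inj.
have -> : lift ord0 (lift ord0 (lift ord0 ord0)) = 3 :> 'I_4 by apply: val_inj.
by congr Quat => /=; ring.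
Qed.

Lemma orderOP x : orderO x <-> exists c0 c1 c2 c3,
  [/\ is_int c0, is_int c1, is_int c2 & is_int c3] /\ x = combO c0 c1 c2 c3.
Proof.
split=> [[c cint ->]|[c0 [c1 [c2 [c3 [[i0 i1 i2 i3] ->]]]]]].
  exists (c 0), (c 1), (c 2), (c 3); split; last exact: sum_basisO.
  by split; exact: cint.
exists (tnth [tuple c0; c1; c2; c3]); last by rewrite sum_basisO !(tnth_nth 0).
by case=> [[|[|[|[|//]]]] lti]; rewrite /ring_of_integers /= (tnth_nth 0).
Qed.

Let n2 : 2 != 0 :> K. Proof. exact: bq_natr_neq0. Qed.

(** The structure constants lie in Z[u]; this gives closure under multiplication. *)
Lemma combOM c0 c1 c2 c3 e0 e1 e2 e3 :
  combO c0 c1 c2 c3 * combO e0 e1 e2 e3 = combO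
    (c0 * e0 - c1 * e1 - c2 * e2 - c3 * e3 - c2 * e1 - u * c3 * e1 - u * c2 * e3)
    (c0 * e1 + c1 * e0 + u * c1 * e1 + u * c2 * e1 - c3 * e2 + c3 * e1 + c2 * e3)
    (c0 * e2 + c2 * e0 + u * c2 * e2 + u * c2 * e1 - c1 * e3 + c3 * e1 + c2 * e3)
    (c0 * e3 + c3 * e0 + c3 * e3 + c1 * e2 - c2 * e1 + u * c1 * e3 + u * c3 * e2).
Proof.
have u2 := bq_u2 K.
by congr Quat => /=; field: u2.
Qed.

Lemma combOB c0 c1 c2 c3 e0 e1 e2 e3 :
  combO c0 c1 c2 c3 - combO e0 e1 e2 e3 =
  combO (c0 - e0) (c1 - e1) (c2 - e2) (c3 - e3).
Proof. by congr Quat => /=; ring. Qed.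

Ltac int_closed := repeat
  first [ assumption | exact: bq_is_int_u
        | exact: (integral_nat (intr : int -> K)) | exact: (integral1 (intr : int -> K))
        | exact: (integral0 (intr : int -> K))
        | apply: integral_sub | apply: integral_add | apply: integral_opp
        | apply: integral_mul ].

Lemma orderO_is_order : is_order orderO.
Proof.
split.
- split=> [|x y|x y]; rewrite !inE.
  + apply/orderOP; exists 1, 0, 0, 0; split; first by split; int_closed.
    by congr Quat => /=; ring.
  + move=> /orderOP[c0 [c1 [c2 [c3 [[? ? ? ?] ->]]]]].
    move=> /orderOP[e0 [e1 [e2 [e3 [[? ? ? ?] ->]]]]].
    by rewrite combOB; apply/orderOP; do 4!eexists; split; [split|reflexivity]; int_closed.
  + move=> /orderOP[c0 [c1 [c2 [c3 [[? ? ? ?] ->]]]]].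
    move=> /orderOP[e0 [e1 [e2 [e3 [[? ? ? ?] ->]]]]].
    by rewrite combOM; apply/orderOP; do 4!eexists; split; [split|reflexivity]; int_closed.
- by exists 4%N, (tnth basisO).
(* These coefficients invert [combO], from the last coordinate up; division by [u / 2] is
   multiplication by [u]. *)
- move=> [x y z t]; exists 4%N, (tnth [tuple x - (y - t) - (z - t) - t;
    (y - t) * u; (z - t) * u; 2 * t]), (tnth basisO); split.
    move=> l; exists (fun m => (m == l)%:R).
      by move=> m; exact: (integral_nat (intr : int -> K)).
    rewrite (bigD1 l) //= eqxx scale1r big1 ?addr0 // => m /negPf ->.
    by rewrite scale0r.
  rewrite sum_basisO !(tnth_nth 0) /=; have u2 := bq_u2 K.
  by congr Quat => /=; field: u2.
Qed.

(* The Gram matrix of the reduced trace form on [basisO] is the square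
   [[u, 1], [1, u]] (x) [[u, 1], [1, u]], whose inverse is integral because
   [u ^+ 2 - 1 = 1]: [orderO] is its own dual, so no order can exceed it. *)
Lemma orderO_maximal : is_maximal_order orderO.
Proof.
split; first exact: orderO_is_order.
move=> O' O'ord [sOO' nO'O]; apply: nO'O => x O'x.
have tr_int c0 c1 c2 c3 : is_int c0 -> is_int c1 -> is_int c2 -> is_int c3 ->
    is_int (2 * q1 (x * combO c0 c1 c2 c3)).
  move=> i0 i1 i2 i3; apply: (order_trace_int (bq_algC K) O'ord).
  case: (O'ord) => [[_ _ OM] _ _].
  have := OM x (combO c0 c1 c2 c3); rewrite !inE; apply=> //.
  by apply: sOO'; apply/orderOP; exists c0, c1, c2, c3.
(* The four right factors are the conjugates of the elements of [basisO], so these traces pair [x]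
   with the basis. *)
have t0 : is_int (2 * q1 (x * combO 1 0 0 0)) by apply: tr_int; int_closed.
have t1 : is_int (2 * q1 (x * combO u (-1) 0 0)) by apply: tr_int; int_closed.
have t2 : is_int (2 * q1 (x * combO u 0 (-1) 0)) by apply: tr_int; int_closed.
have t3 : is_int (2 * q1 (x * combO 1 0 0 (-1))) by apply: tr_int; int_closed.
set T0 := (X in is_int X) in t0; set T1 := (X in is_int X) in t1.
set T2 := (X in is_int X) in t2; set T3 := (X in is_int X) in t3.
(* The coefficients are the rows of the inverse Gram matrix, the tensor square of [[u, -1],
   [-1, u]], with u^2 = 2. *)
apply/orderOP; exists (2 * T0 - u * T1 - u * T2 + T3),
  (- u * T0 + 2 * T1 + T2 - u * T3), (- u * T0 + T1 + 2 * T2 - u * T3),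
  (T0 - u * T1 - u * T2 + 2 * T3); split; first by clear -t0 t1 t2 t3; split; int_closed.
rewrite /T0 /T1 /T2 /T3; clear -x n2.
case: x => x y z t; have u2 := bq_u2 K.
by congr Quat => /=; field: u2.
Qed.

End MaximalOrder.

(** * Orthonormal frames and E8 *)

Section Frame.
Variables (R : realType) (F : fieldExtType rat) (sigma : 'I_4 -> {rmorphism F -> R}).
Variables (a : F) (b : 'I_4 -> F).
Hypothesis a_ge0 : forall m, 0 <= sigma m a.
Hypothesis b_orthonormal : forall s t,
  \sum_m sigma m (2 * a * b s * b t) = (s == t)%:R.

Definition frame_entry (t m : 'I_4) : R := Num.sqrt (2 * sigma m a) * sigma m (b t).

(* Column [8 * s + 2 * l + r] of [frame_mx] reads off the coordinate on
   [b (2 * s + r)] of the [l]-th quaternion component. *)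
Definition frame_row (q : 'I_16) : 'I_4 := inord (q %% 8 %/ 2).
Definition frame_index (q : 'I_16) : 'I_4 := inord (q %/ 8 * 2 + q %% 2).

Definition frame_mx : 'M[R]_16 := \matrix_(p, q)
  mxvec (\matrix_(l < 4, m < 4) ((l == frame_row q)%:R * frame_entry (frame_index q) m)) 0 p.

Lemma frame_row_index_inj q q' :
  ((frame_row q == frame_row q') && (frame_index q == frame_index q')) = (q == q').
Proof.
have lt_row (k : 'I_16) : (k %% 8 %/ 2 < 4)%N by have := ltn_ord k; lia.
have lt_index (k : 'I_16) : (k %/ 8 * 2 + k %% 2 < 4)%N by have := ltn_ord k; lia.
rewrite -!val_eqE /= !inordK //; have := ltn_ord q; have := ltn_ord q'.
by lia.
Qed.

Lemma mxvec_dot m n (A B : 'M[R]_(m, n)) :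
  \sum_p mxvec A 0 p * mxvec B 0 p = \sum_i \sum_j A i j * B i j.
Proof.
rewrite (reindex _ (curry_mxvec_bij m n)) /= pair_bigA /=.
by apply: eq_bigr => -[i j] _; rewrite /= !mxvecE.
Qed.

Lemma frame_dot (M : 'M[R]_(4, 4)) q :
  (mxvec M *m frame_mx) 0 q = \sum_m M (frame_row q) m * frame_entry (frame_index q) m.
Proof.
rewrite mxE; under eq_bigr => p _ do rewrite mxE.
rewrite mxvec_dot (bigD1 (frame_row q)) //= [X in _ + X]big1 ?addr0 => [|l /negPf lq].
  by apply: eq_bigr => m _; rewrite mxE eqxx mul1r.
by rewrite big1 // => m _; rewrite mxE lq mul0r mulr0.
Qed.

(** The square roots multiply to 2 sigma(a), which turns the Euclidean product into the twisted
    trace form. *)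
Lemma frame_entry_dot (X : F) t :
  \sum_m Num.sqrt (2 * sigma m a) * sigma m X * frame_entry t m =
  \sum_m sigma m (2 * a * X * b t).
Proof.
apply: eq_bigr => m _; rewrite /frame_entry mulrACA -expr2 sqr_sqrtr ?mulr_ge0 //.
by rewrite !rmorphM rmorph_nat !mulrA.
Qed.

(** Columns for different quaternion components have disjoint supports; within one component their
    products are the twisted traces of the [b t]. *)
Lemma frame_mx_orthogonal : frame_mx *m frame_mx^T = 1%:M.
Proof.
have entryE p q : frame_mx p q = mxvec (\matrix_(l < 4, m < 4)
    ((l == frame_row q)%:R * frame_entry (frame_index q) m)) 0 p by rewrite mxE.
apply: mulmx1C; apply/matrixP => q q'; rewrite mxE [RHS]mxE -frame_row_index_inj.
under eq_bigr => p _ do rewrite mxE !entryE.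
rewrite (@mxvec_dot 4 4) (bigD1 (frame_row q)) //= [X in _ + X]big1 ?addr0 => [|l /negPf lq].
  under eq_bigr => m _ do rewrite !mxE eqxx mul1r mulrCA.
  by rewrite -mulr_sumr frame_entry_dot b_orthonormal -natrM mulnb.
by rewrite big1 // => m _; rewrite mxE lq !mul0r.
Qed.

(** In an orthonormal basis, coordinates are inner products: the rotated vector lists the rational
    coefficients on [b]. *)
Lemma quat_embedding_frame (x : quat F) (w : 'I_4 -> 'I_4 -> rat) q :
  (forall l : 'I_4, (quat_to_seq x)`_l = \sum_t in_alg F (w l t) * b t) ->
  (quat_embedding sigma a x *m frame_mx) 0 q = ratr (w (frame_row q) (frame_index q)).
Proof.
move=> xw; rewrite frame_dot; under eq_bigr => m _ do rewrite mxE.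
rewrite frame_entry_dot xw.
transitivity (\sum_m \sum_t ratr (w (frame_row q) t) *
    sigma m (2 * a * b t * b (frame_index q))).
  apply: eq_bigr => m _; rewrite mulr_sumr mulr_suml rmorph_sum; apply: eq_bigr => t _.
  rewrite -(fmorph_eq_rat (sigma m \o in_alg F)) /= -rmorphM; congr (sigma m _).
  by ring.
rewrite exchange_big (bigD1 (frame_index q)) //= [X in _ + X]big1 ?addr0 => [|t /negPf tq].
  by rewrite -mulr_sumr b_orthonormal eqxx mulr1.
by rewrite -mulr_sumr b_orthonormal tq mulr0.
Qed.

End Frame.

(** * E8 in coordinates on the quaternion basis *)

Section E8Coordinates.

(* Twice the vector whose entries of index [2 * l] and [2 * l + 1] are
   [x_l + 2 * y_l] and [x_l], where the [x_l + y_l * sqrt 2] are the components of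
   the quaternion with coordinates [g i + h i * sqrt 2] on [basisO]. *)
Definition e8row (g h : 'I_4 -> int) : seq int :=
  [:: 2 * (g 0 + h 1 + h 2 + 2 * h 0 + g 1 + g 2 + h 3) + g 3;
      2 * (g 0 + h 1 + h 2) + g 3;
      2 * (h 1 + g 1 + h 3) + g 3; 2 * h 1 + g 3;
      2 * (h 2 + g 2 + h 3) + g 3; 2 * h 2 + g 3;
      2 * h 3 + g 3; g 3].

(** The parity of [g 3] decides between integral and half-integral vectors; the other coordinates
    are solved for from the last entry backwards. *)
Lemma E8_e8row (R : realType) (v : 'rV[R]_8) : @E8 R v <->
  exists g h, v = \row_i ratr (((e8row g h)`_i)%:~R / 2).
Proof.
have ratrE (z : int) : ratr (z%:~R / 2) = z%:~R / 2 :> R.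
  by rewrite fmorph_div /= ratr_int ratr_nat.
split=> [/E8_coordP[m [b [s [vE sumE]]]]|[g [h ->]]].
  pose z (n : nat) : int := m (inord n).
  have vzE l : v 0 l = (z l)%:~R + b%:R / 2 by rewrite /z inord_val.
  pose g3 : int := 2 * z 7%N + b%:Z; pose h3 : int := z 6%N - z 7%N.
  pose h1 : int := z 3%N - z 7%N; pose h2 : int := z 5%N - z 7%N.
  pose g1 : int := z 2%N - z 3%N - h3; pose g2 : int := z 4%N - z 5%N - h3.
  pose g0 : int := z 1%N - h1 - h2 - z 7%N.
  (* The evenness of the coordinate sum is what makes [h0] an integer. *)
  pose h0 : int := s - (g0 + 2 * h1 + 2 * h2 + g1 + g2 + 2 * h3 + 2 * g3).
  exists (tnth [tuple g0; g1; g2; g3]), (tnth [tuple h0; h1; h2; h3]).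
  have bE : (b%:Z)%:~R = b%:R :> R by clear; case: b.
  move: sumE; rewrite !big_ord_recl big_ord0 !vzE /= => sumE.
  apply/rowP => l; rewrite !mxE vzE ratrE /e8row !(tnth_nth 0) /=.
  case: l => l lt8; do 8?[case: l lt8 => [|l] lt8 /=]; last by [];
    rewrite /h0 /g0 /g1 /g2 /h1 /h2 /h3 /g3 ?(intrD, intrM, rmorphB, rmorphN) /= ?bE;
    rewrite /bump /= in sumE *; lra.
have [q [b gE]] : exists (q : int) (b : bool), g 3 = 2 * q + b%:Z.
  by move: (g 3) => z; exists (z %/ 2)%Z, (z %% 2 == 1)%Z; case: eqP; lia.
split; last first.
  apply/intrP; exists (g 0 + 2 * h 1 + 2 * h 2 + h 0 + g 1 + g 2 + 2 * h 3 + 2 * g 3).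
  rewrite !big_ord_recl big_ord0 !mxE !ratrE /=.
  by rewrite ?(intrD, intrM) /=; lra.
have evenE l : exists z, (e8row g h)`_(l : 'I_8) = 2 * z + b%:Z.
  case: l => l lt8; do 8?[case: l lt8 => [|l] lt8 /=]; try by [];
    rewrite gE ?addrA -?mulrDr; by eexists.
case: b gE evenE => gE evenE; [right|left] => l; apply/intrP; rewrite mxE ratrE;
  have [z ->] := evenE l; exists z; rewrite intrD intrM /=; lra.
Qed.

End E8Coordinates.

(** * The lattice *)

Section Similarity.
Variables (R : realType) (d n m : nat) (K : biquad d).
Hypotheses (oddn : odd n) (oddm : odd m) (sqf : squarefree d).
Hypotheses (d8 : (d %% 8 = 5)%N) (nmd : (n ^ 2 + 4 = d * m ^ 2)%N).
Notation u := (bq_u K).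
Notation v := (bq_v K).
Notation w := (bq_omega K).

Let d_gt0 : (0 < d)%N. Proof. by case: (d) d8. Qed.
Let m_gt0 : (0 < m)%N. Proof. by case: (m) oddm. Qed.

(** The twisted trace form of Z[(1 + sqrt d)/2] has on 1, (1 + sqrt d)/2 the entries m, (m + n)/2
    and (m(1 + d) + 2n)/4. Its determinant (dm^2 - n^2)/4 is 1, so [binary_unimodular] applies. *)
Lemma twist_form : exists p q r s : int, [/\ m%:Z = p ^+ 2 + r ^+ 2,
  m%:Z + n%:Z = 2 * (p * q + r * s),
  m%:Z * (1 + d%:Z) + 2 * n%:Z = 4 * (q ^+ 2 + s ^+ 2) & p * s - q * r = 1].
Proof.
have nmdZ : n%:Z ^+ 2 + 4 = d%:Z * m%:Z ^+ 2.
  by move: nmd; rewrite -!mulnn !expr2 => /(congr1 Posz); rewrite !(PoszD, PoszM).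
pose B : int := ((m + n) %/ 2)%N.
have BE : m%:Z + n%:Z = 2 * B by rewrite /B; lia.
pose k : int := (d %/ 8)%N; have dE : d%:Z = 8 * k + 5 by rewrite /k; lia.
pose C : int := 2 * k * m%:Z + m%:Z + B.
have CE : m%:Z * (1 + d%:Z) + 2 * n%:Z = 4 * C by rewrite dE /C; lia.
have [||p [q [r [s [E1 E2 E3 E4]]]]] := @binary_unimodular m%:Z B C.
- by [].
- suff : 4 * (m%:Z * C) = 4 * (B ^+ 2 + 1) by lia.
  transitivity (m%:Z * (4 * C)); first by ring.
  rewrite -CE; transitivity ((2 * B) ^+ 2 + 4); last by ring.
  rewrite -BE; transitivity (m%:Z ^+ 2 + 2 * m%:Z * n%:Z + d%:Z * m%:Z ^+ 2); first by ring.
  by rewrite -nmdZ; ring.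
by exists p, q, r, s; split=> //; rewrite ?BE ?CE ?E2 ?E3.
Qed.

Variables (p q r s : int).
Hypotheses (mE : m%:Z = p ^+ 2 + r ^+ 2) (nE : m%:Z + n%:Z = 2 * (p * q + r * s)).
Hypotheses (dE : m%:Z * (1 + d%:Z) + 2 * n%:Z = 4 * (q ^+ 2 + s ^+ 2)).
Hypotheses (pqrs : p * s - q * r = 1).

(* The basis of Z[bq_omega] that the reduction of its twisted trace form makes
   orthonormal. *)
Definition beta1 : K := s%:~R - r%:~R * w.
Definition beta2 : K := - q%:~R + p%:~R * w.
(* [m / 2 + n / (2 * sqrt d)] is eps / sqrt d for the unit
   eps = (n + m sqrt d) / 2. *)
Definition twist : K := (2 + u) / 4 * (m%:R / 2 + n%:R / (2 * d%:R) * v).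
(** The elements [u / 2] and [1 - u / 2] are orthonormal for the trace form of Q(sqrt 2) twisted by
    (2 + sqrt 2)/2, where the extra factor 2 comes from [quat_embedding]. *)
Definition frame : 4.-tuple K :=
  [tuple u / 2 * beta1; (1 - u / 2) * beta1; u / 2 * beta2; (1 - u / 2) * beta2].

(** Since [p * s - q * r = 1], passing from 1, [w] to [beta1], [beta2] is a unimodular change of
    basis over Z[sqrt 2]. *)
Lemma is_int_beta (c : K) : is_int c <-> exists g h g' h' : int,
  c = (g%:~R + h%:~R * u) * beta1 + (g'%:~R + h'%:~R * u) * beta2.
Proof.
have pqrsK : p%:~R * s%:~R - q%:~R * r%:~R = 1 :> K.
  by have := congr1 (fun z : int => z%:~R : K) pqrs; rewrite rmorphB !rmorphM rmorph1.
rewrite -[is_int c]/(ring_of_integers c) (ring_of_integersP sqf d8).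
split=> [[g0 [h0 [g1 [h1 ->]]]]|[g [h [g' [h' ->]]]]].
  exists (p * g0 + q * g1), (p * h0 + q * h1), (r * g0 + s * g1), (r * h0 + s * h1).
  rewrite /beta1 /beta2.
  transitivity ((p%:~R * s%:~R - q%:~R * r%:~R) *
    (g0%:~R + h0%:~R * u + (g1%:~R + h1%:~R * u) * w)); last by ring.
  by rewrite pqrsK mul1r.
exists (s * g - q * g'), (s * h - q * h'), (p * g' - r * g), (p * h' - r * h).
by rewrite /beta1 /beta2; ring.
Qed.

Section Embeddings.
Variables (sigma : 'I_4 -> {rmorphism K -> R}).
Hypothesis sigmaE : forall l, sigma l u = (-1) ^+ odd l * Num.sqrt 2 /\
                              sigma l v = (-1) ^+ (1 < l)%N * Num.sqrt d%:R.
Notation x := (Num.sqrt 2 : R).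
Notation y := (Num.sqrt d%:R : R).
Let x2 : x ^+ 2 = 2. Proof. by rewrite sqr_sqrtr. Qed.
Let y2 : y ^+ 2 = d%:R. Proof. by rewrite sqr_sqrtr. Qed.
Let dR0 : d%:R != 0 :> R. Proof. by rewrite pnatr_eq0 -lt0n. Qed.
Let y_gt0 : 0 < y. Proof. by rewrite sqrtr_gt0 ltr0n. Qed.

(** Both factors are positive for every choice of signs: sqrt 2 < 2, and n < m sqrt d because dm^2 =
    n^2 + 4. *)
Lemma twist_gt0 l : 0 < sigma l twist.
Proof.
have [su sv] := sigmaE l.
have -> : sigma l twist = (2 + sigma l u) / 4 * (m%:R / 2 + n%:R / (2 * d%:R) * sigma l v).
  by rewrite /twist; field.
rewrite su sv; apply: mulr_gt0.
  have x_lt2 : x < 2 by rewrite -ltr_sqr ?nnegrE ?sqrtr_ge0 // x2; lra.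
  have x_ge0 : 0 <= x by rewrite sqrtr_ge0.
  by apply: divr_gt0 => //; case: (odd l); rewrite ?expr0 ?expr1; lra.
have ltn : n%:R < m%:R * y.
  rewrite -ltr_sqr ?nnegrE ?mulr_ge0 ?ler0n ?(ltW y_gt0) // exprMn y2.
  by rewrite -!natrX -natrM ltr_nat mulnC -nmd -[X in (X < _)%N]addn0 ltn_add2l.
have n_ge0 : 0 <= n%:R :> R by [].
set e : R := (-1) ^+ _.
have -> : m%:R / 2 + n%:R / (2 * d%:R) * (e * y) = (m%:R * y + e * n%:R) / (2 * y).
  by field: y2; rewrite dR0 gt_eqF.
apply: divr_gt0; last by rewrite mulr_gt0.
by rewrite /e; case: (1 < l)%N; rewrite ?expr0 ?expr1; lra.
Qed.

(* The twisted trace form is a tensor product over the two quadratic subfields. *)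
Lemma twist_trace (c0 c1 e0 e1 : rat) (g0 g1 h0 h1 : int) :
  \sum_l sigma l (2 * twist * ((in_alg K c0 + in_alg K c1 * u) * (g0%:~R + g1%:~R * w))
    * ((in_alg K e0 + in_alg K e1 * u) * (h0%:~R + h1%:~R * w))) =
  ratr (2 * (c0 * e0 + 2 * c1 * e1 + c0 * e1 + c1 * e0)) *
  ((p * g0 + q * g1) * (p * h0 + q * h1) + (r * g0 + s * g1) * (r * h0 + s * h1))%:~R.
Proof.
pose P (U : R) := (2 + U) / 2 * (ratr c0 + ratr c1 * U) * (ratr e0 + ratr e1 * U).
pose Q (V : R) := (m%:R / 2 + n%:R / (2 * d%:R) * V) *
  (g0%:~R + g1%:~R * ((1 + V) / 2)) * (h0%:~R + h1%:~R * ((1 + V) / 2)).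
transitivity (\sum_l P (sigma l u) * Q (sigma l v)).
  apply: eq_bigr => l _.
  have -> : 2 * twist * ((in_alg K c0 + in_alg K c1 * u) * (g0%:~R + g1%:~R * w))
    * ((in_alg K e0 + in_alg K e1 * u) * (h0%:~R + h1%:~R * w)) =
   (2 * ((2 + u) / 4) * (in_alg K c0 + in_alg K c1 * u) * (in_alg K e0 + in_alg K e1 * u)) *
   ((m%:R / 2 + n%:R / (2 * d%:R) * v) * (g0%:~R + g1%:~R * w) * (h0%:~R + h1%:~R * w)).
    by rewrite /twist; ring.
  have sk (c : rat) : sigma l (in_alg K c) = ratr c.
    exact: (fmorph_eq_rat (sigma l \o in_alg K)).
  by rewrite /P /Q /w -!sk; field.
(* The four embeddings run through all pairs of signs, so the sum factors. *)
transitivity ((P x + P (- x)) * (Q y + Q (- y))).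
  rewrite !big_ord_recl big_ord0 /=.
  do 4!rewrite [sigma _ u](proj1 (sigmaE _)) [sigma _ v](proj2 (sigmaE _)).
  by rewrite /= !expr0 !expr1 !mul1r !mulN1r; ring.
congr (_ * _).
  have -> : ratr (2 * (c0 * e0 + 2 * c1 * e1 + c0 * e1 + c1 * e0)) =
    2 * (ratr c0 * ratr e0 + 2 * ratr c1 * ratr e1 + ratr c0 * ratr e1 + ratr c1 * ratr e0) :> R.
    by ring.
  by rewrite /P; field: x2.
have toR (a b : int) : a = b -> a%:~R = b%:~R :> R by move=> ->.
have mR : m%:R = p%:~R ^+ 2 + r%:~R ^+ 2 :> R.
  by transitivity ((p ^+ 2 + r ^+ 2)%:~R : R); [exact: (toR _ _ mE)|ring].
have nR : m%:R + n%:R = 2 * (p%:~R * q%:~R + r%:~R * s%:~R) :> R.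
  transitivity ((m%:Z + n%:Z)%:~R : R); first by ring.
  by rewrite nE; ring.
have dR : m%:R * (1 + d%:R) + 2 * n%:R = 4 * (q%:~R ^+ 2 + s%:~R ^+ 2) :> R.
  transitivity ((m%:Z * (1 + d%:Z) + 2 * n%:Z)%:~R : R); first by ring.
  by rewrite dE; ring.
transitivity (m%:R * g0%:~R * h0%:~R + (m%:R + n%:R) / 2 * (g0%:~R * h1%:~R + g1%:~R * h0%:~R)
   + (m%:R * (1 + d%:R) + 2 * n%:R) / 4 * g1%:~R * h1%:~R : R).
  by rewrite /Q; field: y2.
by rewrite dR nR mR; field.
Qed.

Lemma frame_orthonormal (i j : 'I_4) :
  \sum_l sigma l (2 * twist * tnth frame i * tnth frame j) = (i == j)%:R.
Proof.
(* The parity of [t] selects [u / 2] or [1 - u / 2], and [t < 2] selects [beta1] or [beta2]; each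
   factor of [twist_trace] then becomes a Kronecker delta. *)
pose C0 (t : 'I_4) : rat := (odd t)%:R; pose C1 (t : 'I_4) : rat := (-1) ^+ odd t / 2.
pose G0 (t : 'I_4) := if (t < 2)%N then s else - q.
pose G1 (t : 'I_4) := if (t < 2)%N then - r else p.
have frameE t : tnth frame t =
    (in_alg K (C0 t) + in_alg K (C1 t) * u) * ((G0 t)%:~R + (G1 t)%:~R * w).
  have half : (1 / 2)%:A = 1 / 2 :> K.
    by rewrite -[LHS]/(in_alg K _) fmorph_div rmorph1 rmorph_nat.
  have halfN : (-1 / 2)%:A = -1 / 2 :> K.
    by rewrite -[LHS]/(in_alg K _) fmorph_div rmorphN rmorph1 rmorph_nat.
  rewrite (tnth_nth 0) /C0 /C1 /G0 /G1 /beta1 /beta2.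
  by case: t => [[|[|[|[|//]]]] ?]; rewrite /= ?expr0 ?expr1 ?half ?halfN ?scale1r ?scale0r;
    rewrite /beta1 /beta2; ring.
rewrite !frameE twist_trace.
have -> : 2 * (C0 i * C0 j + 2 * C1 i * C1 j + C0 i * C1 j + C1 i * C0 j) =
    (odd i == odd j)%:R.
  by rewrite /C0 /C1; case: (odd i) (odd j) => [] []; rewrite /= ?expr0 ?expr1; field.
have -> : (p * G0 i + q * G1 i) * (p * G0 j + q * G1 j) +
    (r * G0 i + s * G1 i) * (r * G0 j + s * G1 j) = ((i < 2)%N == (j < 2)%N)%:R.
  have E1 t : p * G0 t + q * G1 t = (t < 2)%N%:R.
    by rewrite /G0 /G1; case: ifP => _ /=; rewrite -?pqrs; ring.
  have E2 t : r * G0 t + s * G1 t = (2 <= t)%N%:R.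
    by rewrite leqNgt /G0 /G1; case: ifP => _ /=; rewrite -?pqrs; ring.
  by rewrite !E1 !E2 !(leqNgt 2); case: (i < 2)%N (j < 2)%N => [] [].
rewrite ratr_nat rmorph_nat -natrM mulnb; congr (_%:R).
by case: i j => [[|[|[|[|//]]]] ?] [[|[|[|[|//]]]] ?].
Qed.

Definition frame_coord (g h g' h' : 'I_4 -> int) (l t : 'I_4) : rat :=
  ((if (t < 2)%N then e8row g h else e8row g' h')`_(2 * l + t %% 2))%:~R / 2.

(** Rests on x + yu = (x + 2y)(u/2) + x(1 - u/2), which explains the pairs of entries in [e8row]. *)
Lemma combO_coord (g h g' h' : 'I_4 -> int) (c : 'I_4 -> K) (l : 'I_4) :
  (forall i, c i = ((g i)%:~R + (h i)%:~R * u) * beta1 +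
                   ((g' i)%:~R + (h' i)%:~R * u) * beta2) ->
  (quat_to_seq (combO (c 0) (c 1) (c 2) (c 3)))`_l =
  \sum_t in_alg K (frame_coord g h g' h' l t) * tnth frame t.
Proof.
move=> cE; have half (z : int) : in_alg K (z%:~R / 2) = z%:~R / 2.
  by rewrite fmorph_div rmorph_int rmorph_nat.
have n2 : 2 != 0 :> K by exact: bq_natr_neq0.
rewrite !big_ord_recl big_ord0 /frame_coord !half !(tnth_nth 0) !cE.
have u2 := bq_u2 K.
by case: l => [[|[|[|[|//]]]] ?]; rewrite /= /bump /=; move: beta1 beta2 => B1 B2; field: u2.
Qed.

(** The column order of [frame_mx] puts the [beta1] part in the first eight coordinates and the
    [beta2] part in the last eight. *)
Lemma quat_embedding_E8 (g h g' h' : 'I_4 -> int) (c : 'I_4 -> K) :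
  (forall i, c i = ((g i)%:~R + (h i)%:~R * u) * beta1 +
                   ((g' i)%:~R + (h' i)%:~R * u) * beta2) ->
  quat_embedding sigma twist (combO (c 0) (c 1) (c 2) (c 3)) *m
    frame_mx sigma twist (tnth frame) =
  row_mx (\row_(i < 8) ratr (((e8row g h)`_i)%:~R / 2))
         (\row_(i < 8) ratr (((e8row g' h')`_i)%:~R / 2)) :> 'rV[R]_(8 + 8).
Proof.
move=> cE; apply/rowP => k.
rewrite (quat_embedding_frame _ frame_orthonormal _ (fun l => combO_coord l cE)); last first.
  by move=> l; rewrite ltW // twist_gt0.
rewrite /frame_coord /frame_row /frame_index -[k]splitK; case: (fintype.split k) => i /=.
  rewrite row_mxEl mxE; congr (ratr (_%:~R / 2)).
  have lti := ltn_ord i; rewrite !inordK; try (clear -lti; lia).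
  rewrite ifT; last by clear -lti; lia.
  by congr (_`_ _); clear -lti; lia.
rewrite row_mxEr mxE; congr (ratr (_%:~R / 2)).
have lti := ltn_ord i; rewrite !inordK; try (clear -lti; lia).
rewrite ifF; last by clear -lti; lia.
by congr (_`_ _); clear -lti; lia.
Qed.

(** An isometry suffices, with scaling factor 1: integral coefficients correspond to arbitrary [g],
    [h], [g'], [h'], and each pair parametrizes one copy of E8. *)
Lemma orderO_similar : similar_lattices
  [set quat_embedding sigma twist z | z in @orderO d K] (@E8_squared R).
Proof.
exists 1, (frame_mx sigma twist (tnth frame)); split=> //.
  by apply: frame_mx_orthogonal frame_orthonormal => l; rewrite ltW // twist_gt0.
rewrite eqEsubset; split=> z.
- case=> -[v1 v2] /= [/E8_e8row[g [h ->]] /E8_e8row[g' [h' ->]]] <-.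
  pose c i := ((g i)%:~R + (h i)%:~R * u) * beta1 +
              ((g' i)%:~R + (h' i)%:~R * u) * beta2.
  exists (quat_embedding sigma twist (combO (c 0) (c 1) (c 2) (c 3))).
    exists (combO (c 0) (c 1) (c 2) (c 3)) => //.
    have cint i : is_int (c i) by apply/is_int_beta; exists (g i), (h i), (g' i), (h' i).
    by apply/orderOP; exists (c 0), (c 1), (c 2), (c 3).
  by rewrite scale1r (@quat_embedding_E8 g h g' h').
- case=> _ [x /orderOP[c0 [c1 [c2 [c3 [[i0 i1 i2 i3] ->]]]]] <-] <-.
  pose c := tnth [tuple c0; c1; c2; c3].
  have cint i : is_int (c i).
    by rewrite /c (tnth_nth 0); case: i => [[|[|[|[|//]]]] ?].
  have /choice[f fE] i : exists f : int * int * int * int,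
      c i = (f.1.1.1%:~R + f.1.1.2%:~R * u) * beta1 + (f.1.2%:~R + f.2%:~R * u) * beta2.
    by have [g [h [g' [h' E]]]] := (is_int_beta (c i)).1 (cint i); exists (g, h, g', h').
  pose g i := (f i).1.1.1; pose h i := (f i).1.1.2.
  pose g' i := (f i).1.2; pose h' i := (f i).2.
  have := @quat_embedding_E8 g h g' h' c fE.
  rewrite {1 2 3 4}/c !(tnth_nth 0) /= scale1r => ->.
  eexists (_, _); last reflexivity.
  by split=> /=; apply/E8_e8row; [exists g, h|exists g', h'].
Qed.

End Embeddings.
End Similarity.

(** Through the isomorphisms, sqrt d' would lie in [K]; but [p] divides d' exactly once and, being
    larger than d, does not divide d. *)
Lemma biquad_not_iso (d d' p : nat) (K : biquad d) (K' : biquad d')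
    (E : fieldExtType rat) : (2 < p)%N -> (d < p)%N -> logn p d' = 1%N ->
  field_iso K E -> ~ field_iso K' E.
Proof.
move=> p2 dp pd' [f [g _ fK]] [f' _].
have d0 : (0 < d)%N by have [q _] := bq_prime K; case: (d) => //; rewrite logn0.
have pd : logn p d = 0%N.
  by apply/eqP; rewrite -leqn0 leqNgt logn_gt0 mem_primes; apply/and3P => -[_ _ /(dvdn_leq d0)];
    rewrite leqNgt dp.
have := @bq_no_sqrt d K p d' (g (f' (bq_v K'))) p2 pd pd'; apply.
apply: (fmorph_inj f); rewrite rmorphXn /= fK -rmorphXn bq_v2.
by rewrite !rmorph_nat.
Qed.

Theorem theorem5 (R : realType) :
  infinitely_many_fields (fun F : fieldExtType rat =>
    [/\ \dim {: F} = 4%N,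
        totally_real R F
      & exists sigma : 'I_4 -> {rmorphism F -> R}, real_embeddings sigma /\
        exists (a : F) (O : set (quat F)),
          [/\ totally_positive R a, is_maximal_order O
            & similar_lattices [set quat_embedding sigma a x | x in O]
                               (@E8_squared R)]]).
Proof.
move=> [N [E HE]].
(* A listed field isomorphic to Q(sqrt 2, sqrt d0) is avoided by every prime [p > d0]; a field
   isomorphic to none of the family needs no bound. *)
have /choice[D HD] (l : 'I_N) : exists D : nat, forall d p (K : biquad d),
    (2 < p)%N -> (D < p)%N -> logn p d = 1%N -> ~ field_iso K (E l).
  have [[d0 [K0 K0E]]|noK] := pselect (exists d (K : biquad d), field_iso K (E l)).
    by exists d0 => d p K p2 dp pd; exact: (biquad_not_iso p2 dp pd K0E).
  by exists 0%N => d p K _ _ _ KE; apply: noK; exists d, K.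
(* The bound makes [p] exceed 2 and every [D l] at once. *)
have [p [n [d [m [pp ltp pd [oddn oddm sqf d8 nmd]]]]]] :=
  family_parameters (2 + \max_l D l).
have p2 : (2 < p)%N by rewrite (leq_ltn_trans _ ltp) // leq_addr.
have [K] := biquad_exists p2 pd.
have [|l] := HE K; last first.
  by apply: (HD l d p) => //; rewrite (leq_ltn_trans _ ltp) // (leq_trans (leq_bigmax l)) // leq_addl.
have [sigma [sigmaR sigmaE]] := bq_real_embeddings R K.
have [p' [q [r [s [mE nE dE pqrs]]]]] := twist_form oddn oddm d8 nmd.
split; [exact: bq_dim|exact: bq_totally_real|exists sigma; split=> //].
exists (twist n m K), (orderO (K := K)); split.
(* Total positivity concerns every real embedding, and each one agrees with some [sigma l]. *)
- move=> f; have [l fl] := sigmaR.2 f; rewrite fl.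
  exact: (twist_gt0 d8 nmd sigmaE).
- exact: orderO_maximal.
- exact: (orderO_similar sqf d8 nmd mE nE dE pqrs sigmaE).
Qed.
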